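(* Let $\mathfrak a,\mathfrak b$ be two ideals of a commutative Noetherian local ring $(R,\mathfrak m)$, and let $M$ be a finitely generated $R$-module. Then there is a long exact sequence $$\cdots\to\varprojlim_n H^i_{\mathfrak m}(M/(\mathfrak a\cap\mathfrak b)^nM)\to\varprojlim_n H^i_{\mathfrak m}(M/\mathfrak a^nM)\oplus\varprojlim_n H^i_{\mathfrak m}(M/\mathfrak b^nM)\to\varprojlim_n H^i_{\mathfrak m}(M/(\mathfrak a,\mathfrak b)^nM)\to\varprojlim_n H^{i+1}_{\mathfrak m}(M/(\mathfrak a\cap\mathfrak b)^nM)\to\cdots$$ where $i\in\mathbb Z$.
   Context: $H^i_{\mathfrak m}$ denotes local cohomology with support in $\mathfrak m$. For an ideal $\mathfrak c$, the inverse limit $\varprojlim_n H^i_{\mathfrak m}(M/\mathfrak c^nM)$ is along the maps induced by the natural surjections $M/\mathfrak c^{n+1}M\to M/\mathfrak c^nM$. $(\mathfrak a,\mathfrak b)$ denotes the ideal $\mathfrak a+\mathfrak b$. *)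

(* Defs.v *)
From HB Require Import structures.
From mathcomp Require Import all_boot all_order all_algebra.
From mathcomp Require Import boolp classical_sets functions.

Set Implicit Arguments.
Unset Strict Implicit.
Unset Printing Implicit Defensive.

Import GRing.Theory Num.Theory.
Local Open Scope classical_set_scope.
Local Open Scope ring_scope.
Local Open Scope quotient_scope.

#[local] Obligation Tactic := idtac.

Record submod (R : pzRingType) (V : lmodType R) := Submod {
  carrier :> V -> Prop;
  submod0 : carrier 0;
  submodL : forall a x y, carrier x -> carrier y -> carrier (a *: x + y) }.

(* The library builds submodules and quotients from boolean predicates. *)
Definition submod_pred (R : pzRingType) (V : lmodType R) (S : submod V) :
  {pred V} := fun x => `[< S x >].

Section SubmodTheory.
Context (R : pzRingType) (V : lmodType R).
Implicit Types S T : submod V.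

Lemma submod_predE S x : (x \in submod_pred S) = `[< S x >].
Proof. by []. Qed.

Lemma submod_pred_closed S : GRing.submod_closed (submod_pred S).
Proof.
split; first exact/asboolP/submod0.
by move=> a x y /asboolP Sx /asboolP Sy; exact/asboolP/submodL.
Qed.

HB.instance Definition _ S :=
  GRing.isSubmodClosed.Build R V (submod_pred S) (submod_pred_closed S).

Lemma submodD S x y : S x -> S y -> S (x + y).
Proof. by move=> Sx Sy; rewrite -[x]scale1r; exact: submodL. Qed.

Lemma submodZ S a x : S x -> S (a *: x).
Proof. by move=> Sx; rewrite -[_ *: _]addr0; exact/submodL/submod0. Qed.

Lemma submodB S x y : S x -> S y -> S (x - y).
Proof. by move=> Sx Sy; rewrite addrC -scaleN1r; exact: submodL. Qed.

Definition submod_top : submod V :=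
  @Submod R V setT I (fun _ _ _ _ _ => I).

Program Definition submod_cap S T : submod V := @Submod R V [set x | S x /\ T x] _ _.
Next Obligation. by move=> S T; split; exact: submod0. Qed.
Next Obligation.
by move=> S T a x y [Sx Tx] [Sy Ty]; split; exact: submodL.
Qed.

Program Definition submod_add S T : submod V :=
  @Submod R V [set x + y | x in carrier S & y in carrier T] _ _.
Next Obligation.
by move=> S T; exists 0; [exact: submod0 | exists 0; [exact: submod0 | exact: addr0]].
Qed.
Next Obligation.
move=> S T a _ _ [x Sx [y Ty <-]] [x' Sx' [y' Ty' <-]].
exists (a *: x + x'); first exact: submodL.
by exists (a *: y + y'); [exact: submodL | rewrite scalerDr addrACA].
Qed.

Program Definition submod_span (A : set V) : submod V :=
  @Submod R V [set x | forall S, A `<=` S -> S x] _ _.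
Next Obligation. by move=> A S _; exact: submod0. Qed.
Next Obligation. by move=> A a x y Ax Ay S AS; apply: submodL; auto. Qed.

Definition fin_gen S : Prop := exists s : seq V, carrier S = carrier (submod_span [set` s]).

End SubmodTheory.

Arguments submod_top {R} V.

Record submodType (R : pzRingType) (V : lmodType R) (S : submod V) :=
  SubmodType { submod_val : V; _ : submod_val \in submod_pred S }.

HB.instance Definition _ (R : pzRingType) (V : lmodType R) (S : submod V) :=
  [isSub for @submod_val R V S].
HB.instance Definition _ (R : pzRingType) (V : lmodType R) (S : submod V) :=
  [Choice of submodType S by <:].
HB.instance Definition _ (R : pzRingType) (V : lmodType R) (S : submod V) :=
  [SubChoice_isSubZmodule of submodType S by <:].
HB.instance Definition _ (R : pzRingType) (V : lmodType R) (S : submod V) :=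
  [SubZmodule_isSubLmodule of submodType S by <:].

Definition insubm (R : pzRingType) (V : lmodType R) (S : submod V) (x : V)
  (Sx : S x) : submodType S := SubmodType (asboolT Sx).

Lemma submod_valP (R : pzRingType) (V : lmodType R) (S : submod V)
  (x : submodType S) : S (val x).
Proof. exact/asboolP/(valP x). Qed.

Definition quotmod (R : pzRingType) (V : lmodType R) (S : submod V) : Type :=
  Quotient.quot (submod_pred S).

Section Quotmod.
Context (R : pzRingType) (V : lmodType R) (S : submod V).

HB.instance Definition _ := GRing.Zmodule.on (quotmod S).

Definition qproj (x : V) : quotmod S := \pi_(Quotient.quot (submod_pred S)) x.
Definition qrepr (q : quotmod S) : V := repr (q : Quotient.quot (submod_pred S)).

Lemma qreprK : cancel qrepr qproj.
Proof. by move=> q; exact: reprK. Qed.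

Lemma qproj_eq x y : qproj x = qproj y <-> S (x - y).
Proof.
split=> [/eqP|Sxy]; last apply/eqP.
  by rewrite /qproj -Quotient.idealrBE => /asboolP.
by rewrite /qproj -Quotient.idealrBE; exact/asboolP.
Qed.

Lemma qprojB : {morph qproj : x y / x - y}.
Proof. by move=> x y; exact: (raddfB \pi_(Quotient.quot (submod_pred S))). Qed.

Lemma qprojD : {morph qproj : x y / x + y}.
Proof. by move=> x y; exact: (raddfD \pi_(Quotient.quot (submod_pred S))). Qed.

Definition qscale (a : R) (q : quotmod S) : quotmod S := qproj (a *: qrepr q).

Lemma qscaleE a x : qscale a (qproj x) = qproj (a *: x).
Proof.
by apply/qproj_eq; rewrite -scalerBr; apply/submodZ/qproj_eq; rewrite qreprK.
Qed.

Fact qscaleA a b q : qscale a (qscale b q) = qscale (a * b) q.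
Proof. by rewrite -[q]qreprK !qscaleE scalerA. Qed.
Fact qscale1 : left_id 1 qscale.
Proof. by move=> q; rewrite -[q]qreprK qscaleE scale1r. Qed.
Fact qscaleDr : right_distributive qscale +%R.
Proof.
by move=> a p q; rewrite -[p]qreprK -[q]qreprK -qprojD !qscaleE -qprojD scalerDr.
Qed.
Fact qscaleDl q : {morph qscale^~ q : a b / a + b}.
Proof. by move=> a b; rewrite -[q]qreprK !qscaleE -qprojD scalerDl. Qed.

HB.instance Definition _ := GRing.Zmodule_isLmodule.Build R (quotmod S)
  qscaleA qscale1 qscaleDr qscaleDl.

Fact qproj_is_linear : linear qproj.
Proof. by move=> a x y; rewrite qprojD -qscaleE. Qed.
HB.instance Definition _ :=
  GRing.isLinear.Build R V (quotmod S) *:%R qproj qproj_is_linear.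

End Quotmod.

Section Induced.
Context (R : pzRingType) (V W : lmodType R) (S : submod V) (T : submod W).
Context (f : {linear V -> W}).
Implicit Type fST : forall x, S x -> T (f x).

Definition restr fST (x : submodType S) : submodType T :=
  insubm (fST _ (submod_valP x)).
Fact restr_is_linear fST : linear (restr fST).
Proof. by move=> a x y; apply: val_inj; rewrite /= linearP. Qed.
HB.instance Definition _ fST := GRing.isLinear.Build R (submodType S)
  (submodType T) *:%R (restr fST) (restr_is_linear fST).

Definition qmap fST (q : quotmod S) : quotmod T := qproj T (f (qrepr q)).
Lemma qmapE fST x : qmap fST (qproj S x) = qproj T (f x).
Proof.
by apply/qproj_eq; rewrite -linearB; apply: (fST); apply/qproj_eq; rewrite qreprK.
Qed.
Fact qmap_is_linear fST : linear (qmap fST).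
Proof.
move=> a p q; rewrite -[p]qreprK -[q]qreprK -linearP !qmapE.
by rewrite -linearP -linearP.
Qed.
HB.instance Definition _ fST := GRing.isLinear.Build R (quotmod S)
  (quotmod T) *:%R (qmap fST) (qmap_is_linear fST).

Program Definition submod_ker : submod V := @Submod R V [set x | f x = 0] _ _.
Next Obligation. exact: linear0. Qed.
Next Obligation. by move=> a x y /= fx fy; rewrite linearP fx fy scaler0 addr0. Qed.

Program Definition submod_im : submod W := @Submod R W (range f) _ _.
Next Obligation. by exists 0 => //; exact: linear0. Qed.
Next Obligation.
by move=> a _ _ [x _ <-] [y _ <-]; exists (a *: x + y) => //; exact: linearP.
Qed.

Program Definition submod_preim : submod V := @Submod R V [set x | T (f x)] _ _.
Next Obligation. by rewrite /= linear0; exact: submod0. Qed.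
Next Obligation. by move=> a x y /= Tx Ty; rewrite linearP; exact: submodL. Qed.

End Induced.

Definition dprod (R : pzRingType) (X : nat -> lmodType R) : Type :=
  forall n, X n.

Section Dprod.
Context (R : pzRingType) (X : nat -> lmodType R).

HB.instance Definition _ := gen_eqMixin (dprod X).
HB.instance Definition _ := gen_choiceMixin (dprod X).

Let zero : dprod X := fun n => 0.
Let opp (x : dprod X) : dprod X := fun n => - x n.
Let add (x y : dprod X) : dprod X := fun n => x n + y n.
Let scale a (x : dprod X) : dprod X := fun n => a *: x n.

Fact dprod_addA : associative add.
Proof. by move=> x y z; apply: functional_extensionality_dep => n; exact: addrA. Qed.
Fact dprod_addC : commutative add.
Proof. by move=> x y; apply: functional_extensionality_dep => n; exact: addrC. Qed.
Fact dprod_add0 : left_id zero add.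
Proof. by move=> x; apply: functional_extensionality_dep => n; exact: add0r. Qed.
Fact dprod_addN : left_inverse zero opp add.
Proof. by move=> x; apply: functional_extensionality_dep => n; exact: addNr. Qed.
HB.instance Definition _ := GRing.isZmodule.Build (dprod X)
  dprod_addA dprod_addC dprod_add0 dprod_addN.

Fact dprod_scaleA a b x : scale a (scale b x) = scale (a * b) x.
Proof. by apply: functional_extensionality_dep => n; exact: scalerA. Qed.
Fact dprod_scale1 : left_id 1 scale.
Proof. by move=> x; apply: functional_extensionality_dep => n; exact: scale1r. Qed.
Fact dprod_scaleDr : right_distributive scale +%R.
Proof. by move=> a x y; apply: functional_extensionality_dep => n; exact: scalerDr. Qed.
Fact dprod_scaleDl x : {morph scale^~ x : a b / a + b}.
Proof. by move=> a b; apply: functional_extensionality_dep => n; exact: scalerDl. Qed.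
HB.instance Definition _ := GRing.Zmodule_isLmodule.Build R (dprod X)
  dprod_scaleA dprod_scale1 dprod_scaleDr dprod_scaleDl.

Context (f : forall n, {linear X n.+1 -> X n}).

Program Definition compatible : submod (dprod X : lmodType R) :=
  @Submod R (dprod X) [set x | forall n, f n (x n.+1) = x n] _ _.
Next Obligation. by move=> n; exact: linear0. Qed.
Next Obligation. by move=> a x y fx fy n; rewrite linearP fx fy. Qed.

Definition invlim : lmodType R := submodType compatible.

End Dprod.

(* Complexes are concentrated in degrees >= 0: the coboundaries in degree 0 are
   zero. *)
Record complex (R : pzRingType) := Complex {
  cobj :> nat -> lmodType R;
  cdiff : forall n, {linear cobj n -> cobj n.+1};
  cdiffK : forall n x, cdiff n.+1 (cdiff n x) = 0 }.
Arguments cdiff {R} c n.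

Record chain_map (R : pzRingType) (C D : complex R) := ChainMap {
  cmap :> forall n, {linear C n -> D n};
  cmapP : forall n x, cmap n.+1 (cdiff C n x) = cdiff D n (cmap n x) }.

Section Cohomology.
Context (R : pzRingType).
Implicit Types C D : complex R.

Definition cocycles C n : submod (C n) := submod_ker (cdiff C n).

Program Definition coboundaries C n : submod (C n) :=
  @Submod R (C n)
    (match n return set (C n) with
     | 0 => [set x | x = 0]
     | k.+1 => range (cdiff C k)
     end) _ _.
Next Obligation. by move=> C [|n] //=; exists 0 => //; exact: linear0. Qed.
Next Obligation.
move=> C [|n] a x y /=; first by move=> -> ->; rewrite scaler0 addr0.
by move=> [u _ <-] [v _ <-]; exists (a *: u + v) => //; exact: linearP.
Qed.

Definition coboundaries_in C n : submod (submodType (cocycles C n)) :=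
  submod_preim (coboundaries C n) (val : {linear submodType _ -> C n}).

Definition cohom C n : lmodType R := quotmod (coboundaries_in C n).

Context (C D : complex R) (phi : chain_map C D).

Lemma cmap_cocycles n x : cocycles C n x -> cocycles D n (phi n x).
Proof. by move=> Cx; rewrite /= -cmapP Cx linear0. Qed.

Lemma cmap_coboundaries n x : coboundaries C n x -> coboundaries D n (phi n x).
Proof.
case: n x => [|n] x /=; first by move=> ->; exact: linear0.
by move=> [y _ <-]; exists (phi n y) => //; rewrite cmapP.
Qed.

Lemma cmap_subproof n (x : submodType (cocycles C n)) :
  coboundaries_in C n x ->
  coboundaries_in D n (restr (@cmap_cocycles n) x).
Proof. exact: cmap_coboundaries. Qed.

Definition cohom_map n : {linear cohom C n -> cohom D n} :=
  qmap (f := restr (@cmap_cocycles n)) (@cmap_subproof n).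

End Cohomology.

(* The next four sections prove that there are enough injectives, so that
   local cohomology can be defined from actual injective resolutions: divisible
   groups are injective over the integers, and [Hom_Z(R, D)] is injective over
   [R] when [D] is divisible. *)

Section DivisibleExtension.
Variables (A B D : zmodType) (f : {additive A -> B}) (g : {additive A -> D}).
Hypothesis f_inj : injective f.
Hypothesis D_div : forall n (x : D), (0 < n)%N -> exists y, y *+ n = x.

Let partial (G : set (B * D)) :=
  [/\ G !=set0 -> [set (f x, g x) | x in setT] `<=` G,
      forall u v, G u -> G v -> G (u - v) & forall d, G (0, d) -> d = 0].

Let partial_graph : partial [set (f x, g x) | x in setT].
Proof.
split=> [_ u //|_ _ [x _ <-] [y _ <-]|d [x _ [fx <-]]].
  by exists (x - y) => //; rewrite !raddfB.
by have -> : x = 0 by [apply: f_inj; rewrite fx raddf0]; rewrite raddf0.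
Qed.

Let partial_union (F : set (set (B * D))) :
  F `<=` partial -> total_on F subset -> partial (\bigcup_(X in F) X).
Proof.
move=> FP Ftot; split.
- move=> [u [X FX Xu]] v gv; exists X => //.
  by have [XP _ _] := FP _ FX; apply: XP gv; exists u.
- move=> u v [X FX Xu] [Y FY Yv]; have [XY|YX] := Ftot _ _ FX FY.
    by exists Y => //; have [_ YB _] := FP _ FY; apply: YB => //; exact: XY.
  by exists X => //; have [_ XB _] := FP _ FX; apply: XB => //; exact: YX.
- by move=> d [X FX Xd]; have [_ _ X0] := FP _ FX; exact: X0.
Qed.

Lemma divisible_extension :
  exists h : {additive B -> D}, forall x, h (f x) = g x.
Proof.
have [G [[Gg GB G0] Gmax]] := Zorn_bigcup partial_union.
have Gn0 : G !=set0.
  apply: contrapT => /set0P/negP; rewrite negbK => /eqP G_0.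
  apply: (Gmax _ _ partial_graph); rewrite G_0; split => //.
  by move=> /(_ (f 0, g 0)); apply; exists 0.
have {}Gg x : G (f x, g x) by apply: (Gg Gn0); exists x.
have G00 : G 0 by have := GB _ _ (Gg 0) (Gg 0); rewrite subrr.
have GN u : G u -> G (- u) by move=> Gu; rewrite -sub0r; exact: GB.
have GD u v : G u -> G v -> G (u + v).
  by move=> Gu Gv; rewrite -[v]opprK; apply: GB => //; exact: GN.
have GMn u n : G u -> G (u *+ n).
  by move=> Gu; elim: n => [|n IH]; rewrite ?mulr0n// mulrS; exact: GD.
have GMz u k : G u -> G (u *~ k).
  move=> Gu; case: k => n; first exact: GMn.
  by rewrite NegzE mulrNz; apply: GN; exact: GMn.
have pB (b b' : B) (d d' : D) : (b, d) - (b', d') = (b - b', d - d') by [].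
have Gfun b d d' : G (b, d) -> G (b, d') -> d = d'.
  by move=> Gd Gd'; apply/subr0_eq/G0; have := GB _ _ Gd Gd'; rewrite pB subrr.
have Gtot b : exists d, G (b, d).
  apply: contrapT => nGb.
  have [e He] : exists e, forall k d, G (b *~ k, d) -> d = e *~ k.
    have [[n n_gt0 Gn]|noG] :=
      pselect (exists2 n, (0 < n)%N & exists d, G (b *+ n, d)); last first.
      exists 0 => k d Gkd; rewrite mul0rz.
      have [k0|k0] := eqVneq k 0; first by move: Gkd; rewrite k0 mulr0z => /G0.
 exfalso; apply: noG; exists `|k|%N; first by rewrite absz_gt0.
      case: k k0 Gkd => k k0 Gkd; first by exists d.
      by exists (- d); have : G (- (b *~ Negz k), - d) := GN _ Gkd; rewrite NegzE mulrNz opprK.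
    pose Q n := (0 < n)%N && `[< exists d, G (b *+ n, d) >].
    have exQ : exists n, Q n by exists n; rewrite /Q n_gt0; exact/asboolP.
    case: (ex_minnP exQ) => p /andP[p0 /asboolP[d Gpd]] pmin.
    have [e ed] := D_div d p0.
    have Ge : G (b *~ p%:Z, e *~ p%:Z) by rewrite -!pmulrn ed.
    exists e => k d' Gkd'.
    have Gq : G (b *~ (p%:Z * (k %/ p)%Z), e *~ (p%:Z * (k %/ p)%Z)).
      rewrite !mulrzA; move: (GMz _ (k %/ p)%Z Ge); congr (G _).
      have pairMz (u : B * D) z : u *~ z = (u.1 *~ z, u.2 *~ z).
        have Mn n' : u *+ n' = (u.1 *+ n', u.2 *+ n').
          by elim: n' => // n' IH; rewrite !mulrS IH.
        by case: z => z; rewrite ?NegzE ?mulrNz -!pmulrn Mn.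
      by rewrite pairMz.
    have := divz_eq k p; set r := (k %% p)%Z => kE.
    have r0 : r = 0.
      have rp : (`|r| < p)%N.
        have := ltz_mod k (_ : p%:Z != 0); rewrite -lt0n => /(_ p0).
        by rewrite -ltz_nat gez0_abs ?modz_ge0// -lt0n.
      have rE : r = `|r|%N by rewrite gez0_abs// modz_ge0// -lt0n.
      apply/eqP; rewrite -absz_eq0; apply: contraTT rp; rewrite -lt0n -leqNgt => r_gt0.
      apply: pmin; rewrite /Q r_gt0; apply/asboolP.
      exists (d' - e *~ (p%:Z * (k %/ p)%Z)); have := GB _ _ Gkd' Gq.
      rewrite pmulrn -rE pB -mulrzBr; congr (G (b *~ _, _)).
      by rewrite {1}kE mulrC addrC addrA addNr add0r.
    move: kE; rewrite r0 addr0 mulrC => kE; rewrite -kE in Gq.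
    exact: Gfun Gkd' Gq.
  pose G' := [set u : B * D | exists k, G (u.1 - b *~ k, u.2 - e *~ k)].
  apply: (Gmax G'); last first.
    split.
    - by move=> _ _ [x _ <-]; exists 0; rewrite !mulr0z !subr0; exact: Gg.
    - move=> u v [k Gu] [l Gv]; exists (k - l); have := GB _ _ Gu Gv.

      have E (X : zmodType) (x y z t : X) : (x - z) - (y - t) = (x - y) - (z - t).
        by rewrite !opprD addrACA.
      by rewrite !mulrzBr (E B) (E D).
    - move=> d [k /=]; rewrite sub0r -mulrNz => /He/eqP.
      by rewrite subr_eq mulrNz addNr => /eqP.
  split.
    by move=> u Gu; exists 0; rewrite !mulr0z !subr0; case: u Gu.
  move=> /(_ (b, e)); move=> H; apply: nGb; exists e; apply: H.
  by exists 1; rewrite !mulr1z !subrr.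
pose h b := projT1 (cid (Gtot b)).
have Gh b : G (b, h b) by exact: projT2 (cid (Gtot b)).
have hB : zmod_morphism h.
  by move=> x y; apply: Gfun (Gh _) _; exact: (GB _ _ (Gh x) (Gh y)).
pose hM := GRing.isZmodMorphism.Build _ _ h hB.
pose hA : {additive B -> D} := HB.pack h hM.
exists hA => x /=.
exact: Gfun (Gh _) (Gg _).
Qed.

End DivisibleExtension.

Definition injective_mod (R : pzRingType) (I : lmodType R) : Prop :=
  forall (A B : lmodType R) (f : {linear A -> B}) (g : {linear A -> I}),
    injective f -> exists h : {linear B -> I}, forall x, h (f x) = g x.

(* [Hom_Z(R, D)] with the action [(a f) r = f (r a)]. *)
Section Coinduced.
Context (R : pzRingType) (D : zmodType).

Definition coind_pred : {pred R -> D} := fun f => `[< zmod_morphism f >].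

Fact coind_pred_closed : zmod_closed coind_pred.
Proof.
split; first by apply/asboolP => x y; rewrite /GRing.zero/= subr0.
move=> f g /asboolP fB /asboolP gB; apply/asboolP => x y.
by rewrite !fctE fB gB !opprD !opprK addrACA.
Qed.
HB.instance Definition _ :=
  GRing.isZmodClosed.Build (R -> D) coind_pred coind_pred_closed.

Record coind := Coind { coind_fun : R -> D; _ : coind_fun \in coind_pred }.
HB.instance Definition _ := [isSub for coind_fun].
HB.instance Definition _ := [Choice of coind by <:].
HB.instance Definition _ := [SubChoice_isSubZmodule of coind by <:].

Lemma coindB (f : coind) : zmod_morphism (val f).
Proof. exact/asboolP/(valP f). Qed.

Lemma coindD (f : coind) : {morph val f : x y / x + y}.
Proof.
have f0 : val f 0 = 0 by have := coindB f 0 0; rewrite !subrr.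
have fN y : val f (- y) = - val f y by have := coindB f 0 y; rewrite f0 !sub0r.
by move=> x y; rewrite -[y]opprK coindB (fN (- y)).
Qed.

Fact coind_scale_subproof a (f : coind) : (fun r => val f (r * a)) \in coind_pred.
Proof. by apply/asboolP => x y; rewrite mulrBl coindB. Qed.
Definition coind_scale a f := Coind (coind_scale_subproof a f).

Fact coind_scaleA a b f : coind_scale a (coind_scale b f) = coind_scale (a * b) f.
Proof. by apply: val_inj; apply/funext => r /=; rewrite mulrA. Qed.
Fact coind_scale1 : left_id 1 coind_scale.
Proof. by move=> f; apply: val_inj; apply/funext => r /=; rewrite mulr1. Qed.
Fact coind_scaleDr : right_distributive coind_scale +%R.
Proof. by move=> a f g; apply: val_inj; apply/funext. Qed.
Fact coind_scaleDl f : {morph coind_scale^~ f : a b / a + b}.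
Proof.
by move=> a b; apply: val_inj; apply/funext => r /=; rewrite mulrDr coindD.
Qed.
HB.instance Definition _ := GRing.Zmodule_isLmodule.Build R coind
  coind_scaleA coind_scale1 coind_scaleDr coind_scaleDl.

Lemma coind_injective :
  (forall n (x : D), (0 < n)%N -> exists y, y *+ n = x) -> injective_mod coind.
Proof.
move=> Ddiv A B f g f_inj.
pose g1 (x : A) : D := val (g x) 1.
have g1B : zmod_morphism g1 by move=> x y; rewrite /g1 raddfB.
pose g1M := GRing.isZmodMorphism.Build _ _ g1 g1B.
pose g1A : {additive A -> D} := HB.pack g1 g1M.
have [h hf] := divisible_extension g1A f_inj Ddiv.
have hP (y : B) : (fun r : R => h (r *: y)) \in coind_pred.
  by apply/asboolP => r s; rewrite scalerBl raddfB.
pose k y := Coind (hP y).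
have kL : linear k.
  move=> a x y; apply: val_inj; apply/funext => r /=.
  by rewrite scalerDr raddfD scalerA.
pose kM := GRing.isLinear.Build R B coind *:%R k kL.
pose kA : {linear B -> coind} := HB.pack k kM.
exists kA => x; apply: val_inj; apply/funext => r /=.
by rewrite -linearZ /= hf /= /g1 linearZ /= mul1r.
Qed.

End Coinduced.

(* A divisible group containing [M]: the quotient of [M -> rat] by the kernel of
   [Z^(M) -> M]. *)
Section DivisibleHull.
Context (M : zmodType).

Let funMn (u : M -> rat) n : u *+ n = fun y => u y *+ n.
Proof. by elim: n => // n IH; rewrite mulrS IH; apply/funext => y; rewrite mulrS. Qed.

Let delta (x : M) : M -> rat := fun y => (x == y)%:R.

Definition rel_pred : {pred M -> rat} := fun u =>
  `[< exists s : seq (int * M), u = \sum_(p <- s) delta p.2 *~ p.1 /\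
                                \sum_(p <- s) p.2 *~ p.1 = 0 >].

Fact rel_pred_closed : zmod_closed rel_pred.
Proof.
split; first by apply/asboolP; exists [::]; rewrite !big_nil.
move=> u v /asboolP[s [-> s0]] /asboolP[t [-> t0]]; apply/asboolP.
exists (s ++ [seq (- p.1, p.2) | p <- t]).
rewrite !big_cat !big_map /= s0; split.
  by congr (_ + _); rewrite -sumrN; apply: eq_bigr => p _; rewrite mulrNz.
rewrite add0r; apply: (etrans _ (etrans (congr1 -%R t0) (oppr0 _))).
by rewrite -sumrN; apply: eq_bigr => p _; rewrite mulrNz.
Qed.
HB.instance Definition _ :=
  GRing.isZmodClosed.Build (M -> rat) rel_pred rel_pred_closed.

Definition divhull : zmodType := Quotient.quot rel_pred.
Definition divhull_in (x : M) : divhull := \pi_(Quotient.quot rel_pred) (delta x).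

Lemma divhull_div n (q : divhull) : (0 < n)%N -> exists y, y *+ n = q.
Proof.
move=> n0; pose u : M -> rat := fun y => repr q y / n%:R.
exists (\pi_(Quotient.quot rel_pred) u); rewrite -raddfMn -[RHS]reprK.
congr (\pi_(Quotient.quot rel_pred) _); rewrite funMn; apply/funext => y.
by rewrite -mulr_natr divfK// pnatr_eq0 -lt0n.
Qed.

Lemma divhull_inB : zmod_morphism divhull_in.
Proof.
move=> x y; rewrite /divhull_in -raddfB; apply/eqP.
rewrite -Quotient.idealrBE; apply/asboolP.
exists [:: (1, x - y); (-1, x); (1, y)].
rewrite !big_cons !big_nil /= !mulrNz !mulr1z !addr0; split.
  by rewrite opprB; congr (_ + _); exact: addrC.
by rewrite addrACA subrr addNr addr0.
Qed.

Lemma divhull_in_inj : injective divhull_in.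
Proof.
move=> x y xy; apply/subr0_eq; move: xy.
move/eqP; rewrite /divhull_in -Quotient.idealrBE => /asboolP[s [sE s0]].
pose t := (-1, x) :: (1, y) :: s.
have tE : \sum_(p <- t) delta p.2 *~ p.1 = 0.
  have E (X : zmodType) (u v : X) : - u + (v + (u - v)) = 0.
    by rewrite [v + _]addrC subrK addNr.
  by rewrite !big_cons -sE /= mulrNz !mulr1z; exact: E.
suff t0 : \sum_(p <- t) p.2 *~ p.1 = 0.
  move: t0; rewrite !big_cons s0 /= mulrNz !mulr1z addr0 addrC => yx.
  by rewrite -opprB yx oppr0.
pose ys := undup [seq p.2 | p <- t].
transitivity (\sum_(p <- t) \sum_(y <- ys) (y *~ p.1) *+ (p.2 == y)).
  rewrite !big_seq; apply: eq_bigr => p pt.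
  rewrite (bigD1_seq p.2) ?undup_uniq ?mem_undup ?map_f//= eqxx mulr1n.
  rewrite big1 ?addr0// => z; rewrite eq_sym => /negPf->; exact: mulr0n.
rewrite exchange_big /= big1 // => z _.
have zE : \sum_(p <- t) p.1 *+ (p.2 == z) = 0.
  apply: (@intr_inj rat); have := congr1 (@^~ z) tE.
  rewrite fct_sumE /= => H; rewrite rmorph0 -[RHS]H rmorph_sum /=.
  apply: eq_bigr => p _; rewrite rmorphMn /= /delta.
  have -> : (fun y0 => (p.2 == y0)%:R) *~ p.1 = fun y0 => (p.2 == y0)%:R *~ p.1 :> rat.
    by apply/funext => y0; case: p.1 => n; rewrite ?NegzE ?mulrNz -!pmulrn ?funMn.
  by case: (p.2 == z); rewrite ?mulr1n ?mulr0n ?mul0rz.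
transitivity (z *~ \sum_(p <- t) p.1 *+ (p.2 == z)); last by rewrite zE mulr0z.
rewrite (big_morph (fun k => z *~ k) (fun a b => mulrzDr z a b) (mulr0z z)).
by apply: eq_bigr => p _; case: (p.2 == z); rewrite ?mulr1n ?mulr0n ?mulr0z.
Qed.

End DivisibleHull.

Section EnoughInjectives.
Context (R : pzRingType) (M : lmodType R).

Definition inj_hull : lmodType R := coind R (divhull M).

Fact inj_in_subproof (x : M) :
  (fun r : R => divhull_in (r *: x)) \in @coind_pred R (divhull M).
Proof. by apply/asboolP => r s; rewrite scalerBl divhull_inB. Qed.
Definition inj_in (x : M) : inj_hull := Coind (inj_in_subproof x).

Fact inj_in_is_linear : linear inj_in.
Proof.
have D (x y : M) : divhull_in (x + y) = divhull_in x + divhull_in y.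
  have in0 : divhull_in (0 : M) = 0 by have := divhull_inB (0 : M) 0; rewrite !subrr.
  have inN z : divhull_in (- z) = - divhull_in z :> divhull M.
    by have := divhull_inB 0 z; rewrite in0 !sub0r.
  by rewrite -[y]opprK divhull_inB (inN (- y)).
move=> a x y; apply: val_inj; apply/funext => r /=.
by rewrite scalerDr D scalerA.
Qed.
HB.instance Definition _ :=
  GRing.isLinear.Build R M inj_hull *:%R inj_in inj_in_is_linear.

Lemma inj_in_inj : injective inj_in.
Proof.
move=> x y /(congr1 val)/(congr1 (@^~ 1)) /=; rewrite !scale1r.
exact: divhull_in_inj.
Qed.

Lemma inj_hull_injective : injective_mod inj_hull.
Proof. exact/coind_injective/divhull_div. Qed.

End EnoughInjectives.

Record injres (R : pzRingType) (M : lmodType R) := InjRes {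
  rescpx :> complex R;
  aug : {linear M -> rescpx 0};
  res_inj : forall n, injective_mod (rescpx n);
  aug_inj : injective aug;
  aug_exact : forall x, cdiff rescpx 0 x = 0 <-> exists y, aug y = x;
  res_exact : forall n x,
    cdiff rescpx n.+1 x = 0 <-> exists y, cdiff rescpx n y = x }.
Arguments aug {R M} i.
Arguments res_inj {R M} i n.

(* [0 -> M -> E_0 -> E_1 -> ...] where [E_0] is an injective module containing
   [M] and [E_(n+1)] one containing the cokernel of the previous map. *)
Section Resolution.
Context (R : pzRingType) (M : lmodType R).

Let stage := {P : lmodType R & {I : lmodType R & {linear P -> I}}}.
Let mk (P I : lmodType R) (d : {linear P -> I}) : stage :=
  existT _ P (existT _ I d).

Definition res_step (s : stage) : stage :=
  let d := projT2 (projT2 s) in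
  mk (@inj_in R (quotmod (submod_im d)) \o qproj (submod_im d)).

Definition res_stage (n : nat) : stage := iter n res_step (mk (@inj_in R M)).

Definition res_obj (n : nat) : lmodType R := projT1 (projT2 (res_stage n)).

Definition res_diff (n : nat) : {linear res_obj n -> res_obj n.+1} :=
  projT2 (projT2 (res_stage n.+1)).

Lemma res_diff_exact n x : res_diff n x = 0 <->
  exists y, projT2 (projT2 (res_stage n)) y = x.
Proof.
pose S := submod_im (projT2 (projT2 (res_stage n))).
have -> : res_diff n x = inj_in (qproj S x) by [].
rewrite -(raddf0 (@inj_in R (quotmod S))) -(linear0 (qproj S)).
split=> [/inj_in_inj/qproj_eq|[y yx]].
  by rewrite subr0 => -[y _ yx]; exists y.
by congr inj_in; apply/qproj_eq; rewrite subr0; exists y.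
Qed.

Fact res_diffK n x : res_diff n.+1 (res_diff n x) = 0.
Proof. by apply/res_diff_exact; exists x. Qed.

Definition res_cpx : complex R := Complex res_diffK.

Fact res_obj_inj n : injective_mod (res_cpx n).
Proof. by case: n => [|n]; exact: inj_hull_injective. Qed.

Definition res : injres M :=
  @InjRes R M res_cpx (@inj_in R M) res_obj_inj (@inj_in_inj R M)
    (@res_diff_exact 0%N) (fun n => @res_diff_exact n.+1).

End Resolution.

Section Comparison.
Context (R : pzRingType).

Lemma injective_factor (A B J : lmodType R) (d : {linear A -> B})
    (h : {linear A -> J}) :
  injective_mod J -> (forall x, d x = 0 -> h x = 0) ->
  exists k : {linear B -> J}, forall x, k (d x) = h x.
Proof.
move=> Jinj dh.
pose I := submod_im d.
pose s (y : submodType I) : A := sval (cid2 (submod_valP y)).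
have sE y : d (s y) = val y by exact: s2valP' (cid2 (submod_valP y)).
have hE x x' : d x = d x' -> h x = h x'.
  by move=> e; apply/subr0_eq; rewrite -linearB; apply: dh; rewrite linearB e subrr.
have gL : linear (h \o s).
  by move=> a x y /=; rewrite -linearP; apply: hE; rewrite linearP !sE linearP.
pose gM := GRing.isLinear.Build R (submodType I) J *:%R (h \o s) gL.
pose g : {linear submodType I -> J} := HB.pack (h \o s) gM.
have [k kE] := Jinj _ _ (val : {linear submodType I -> B}) g val_inj.
exists k => x; have Ix : I (d x) by exists x.
by rewrite -[d x]/(val (insubm Ix)) kE /=; apply: hE; rewrite sE.
Qed.

Context (M N : lmodType R) (I : injres M) (J : injres N).

Lemma lift_exists (f : {linear M -> N}) :
  exists phi : chain_map I J, forall x, phi 0%N (aug I x) = aug J (f x).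
Proof.
have [phi0 phi0E] := @injective_factor _ _ (J 0%N) (aug I) (aug J \o f) (res_inj J 0)
  (fun x Ix => etrans (congr1 (aug J \o f) (aug_inj (etrans Ix (esym (raddf0 _)))))
     (raddf0 (aug J \o f))).
pose good n (phi : {linear I n -> J n}) :=
  forall x, cdiff I n x = 0 -> cdiff J n (phi x) = 0.
have good0 : good 0%N phi0.
  by move=> x /aug_exact[y <-]; rewrite phi0E; apply/aug_exact; exists (f y).
have step n (phi : {phi | good n phi}) :
  {psi : {psi | good n.+1 psi} |
    forall x, sval psi (cdiff I n x) = cdiff J n (sval phi x)}.
  apply: cid; case: phi => phi gphi /=.
  have [psi psiE] := @injective_factor _ _ (J n.+1) (cdiff I n) (cdiff J n \o phi)
    (res_inj J n.+1) gphi.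
  have gpsi : good n.+1 psi.
    by move=> x /res_exact[y <-]; rewrite psiE; exact: cdiffK.
  by exists (exist _ psi gpsi).
pose phi := fix phi n : {phi | good n phi} :=
  if n is k.+1 then sval (step k (phi k)) else exist _ phi0 good0.
exists (@ChainMap _ _ _ (fun n => sval (phi n)) (fun n => svalP (step n (phi n)))).
exact: phi0E.
Qed.

(* A lift is unique only up to homotopy; any choice induces the same map on the
   cohomology of the complexes obtained by applying an additive functor. *)
Definition lift (f : {linear M -> N}) : chain_map I J := sval (cid (lift_exists f)).

Lemma liftP f x : lift f 0%N (aug I x) = aug J (f x).
Proof. exact: svalP (cid (lift_exists f)) x. Qed.

End Comparison.

Notation ideal R := (submod (GRing.regular R)).

Section Ideals.
Context (R : comNzRingType).
Implicit Types (c m : ideal R) (M : lmodType R).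

Definition ideal_mul c M (S : submod M) : submod M :=
  submod_span [set r *: x | r in carrier c & x in carrier S].

Fixpoint ideal_exp c n : ideal R :=
  if n is k.+1 then ideal_mul c (ideal_exp c k) else submod_top R^o.

Definition noetherian : Prop := forall c, fin_gen c.

Definition maximal_ideal m : Prop :=
  ~ m 1 /\ forall c, carrier m `<=` carrier c -> ~ c 1 -> carrier c = carrier m.

Definition local_ring m : Prop :=
  maximal_ideal m /\ forall c, maximal_ideal c -> carrier c = carrier m.

End Ideals.

Arguments noetherian R : clear implicits.

Section LocalCohomology.
Context (R : comNzRingType) (m : ideal R).
Implicit Types M N : lmodType R.

Lemma ideal_exp_le n k r : (k <= n)%N -> ideal_exp m n r -> ideal_exp m k r.
Proof.
move=> /subnK <-; elim: (n - k)%N r => // l IH r; apply => _ [a _ [b mb <-]].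
exact/submodZ/IH.
Qed.

Program Definition Gamma M : submod M :=
  @Submod R M [set x | exists n, forall r, ideal_exp m n r -> r *: x = 0] _ _.
Next Obligation. by move=> M; exists 0%N => r _; exact: scaler0. Qed.
Next Obligation.
move=> M a x y [k kx] [l ly]; exists (maxn k l) => r mr.
rewrite scalerDr scalerA [r * a]mulrC -scalerA kx ?ly ?scaler0 ?addr0//.
- exact: ideal_exp_le (leq_maxr _ _) mr.
- exact: ideal_exp_le (leq_maxl _ _) mr.
Qed.

Lemma Gamma_map M N (f : {linear M -> N}) x : Gamma M x -> Gamma N (f x).
Proof. by move=> [n nx]; exists n => r mr; rewrite -linearZ nx// linear0. Qed.

Definition Gamma_diff (C : complex R) n :
    {linear submodType (Gamma (C n)) -> submodType (Gamma (C n.+1))} :=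
  restr (@Gamma_map _ _ (cdiff C n)).

Fact Gamma_diffK (C : complex R) n x :
  Gamma_diff C n.+1 (Gamma_diff C n x) = 0.
Proof. by apply: val_inj; exact: cdiffK. Qed.

Definition Gamma_cpx (C : complex R) : complex R := Complex (@Gamma_diffK C).

Definition Gamma_cmap_fun (C D : complex R) (phi : chain_map C D) n :
    {linear Gamma_cpx C n -> Gamma_cpx D n} :=
  restr (@Gamma_map _ _ (phi n)).

Fact Gamma_cmapP (C D : complex R) (phi : chain_map C D) n x :
  Gamma_cmap_fun phi n.+1 (cdiff (Gamma_cpx C) n x) =
  cdiff (Gamma_cpx D) n (Gamma_cmap_fun phi n x).
Proof. by apply: val_inj; exact: cmapP. Qed.

Definition Gamma_cmap (C D : complex R) (phi : chain_map C D) :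
  chain_map (Gamma_cpx C) (Gamma_cpx D) := ChainMap (Gamma_cmapP phi).

(* The i-th right derived functor of [Gamma], which vanishes for i < 0. *)
Definition loccoh (i : int) M : lmodType R :=
  match i with
  | Posz n => cohom (Gamma_cpx (res M)) n
  | Negz _ => 'rV[R]_0
  end.

Definition loccoh_map (i : int) M N (f : {linear M -> N}) :
    {linear loccoh i M -> loccoh i N} :=
  match i with
  | Posz n => cohom_map (Gamma_cmap (lift (res M) (res N) f)) n
  | Negz _ => idfun
  end.

Context (c : ideal R) (M : lmodType R).

Definition adic_sub n : submod M := ideal_mul (ideal_exp c n) (submod_top M).

Fact adic_sub_le n x : adic_sub n.+1 x -> adic_sub n x.
Proof.
apply=> _ [r cr [y _ <-]] S; apply; exists r; last by exists y.
by apply: cr => _ [a _ [b cb <-]]; exact: submodZ.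
Qed.

Definition adic_proj n :
    {linear quotmod (adic_sub n.+1) -> quotmod (adic_sub n)} :=
  qmap (f := idfun) (@adic_sub_le n).

Definition formal_coh (i : int) : lmodType R :=
  invlim (fun n => loccoh_map i (adic_proj n)).

End LocalCohomology.

Definition exact_at (R : pzRingType) (A B C : lmodType R)
    (f : {linear A -> B}) (g : {linear B -> C}) : Prop :=
  forall y, g y = 0 <-> exists x, f x = y.

(* Main.v *)
From HB Require Import structures.
Require Import Defs.
From mathcomp Require Import all_boot all_order all_algebra.
From mathcomp Require Import boolp classical_sets functions.
Import GRing.Theory.
Local Open Scope ring_scope.
Local Open Scope classical_set_scope.

Set Implicit Arguments.
Unset Strict Implicit.
Unset Printing Implicit Defensive.

#[local] Obligation Tactic := idtac.

(* For each n the square of projections of M/(a^nM \cap b^nM) to M/a^nM and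
   M/b^nM, and of these to M/(a^nM + b^nM), gives a short exact sequence, hence
   a Mayer-Vietoris sequence of local cohomology, natural in n.  All modules in
   it are Artinian, so the affine conditions that lifting along an inverse limit
   amounts to satisfy Mittag-Leffler, and the limit is exact.  By Artin-Rees the
   filtrations a^nM \cap b^nM and (a \cap b)^nM are cofinal, and so are
   a^nM + b^nM and (a + b)^nM, which identifies the limits.

   Artin-Rees in the weak form needed here and the injectivity of Gamma_m(E) for
   E injective both come from one maximality argument: choose W maximal with
   W \cap A contained in P; if every element of an ideal acts nilpotently on
   A modulo P, then it does so modulo W, because the kernels of its powers
   stabilise.  Artinianness of H^i_m(M) is reduced to cyclic modules and proved
   by Noetherian induction on the annihilator c.  For y in m outside c, if
   (c : y) is larger than c there is an extension of smaller cases; otherwise y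
   is a nonzerodivisor on R/c, the kernel of y on H^i_m is a quotient of some
   H^j_m of the smaller case R/(c + (y)) (or zero), and a y-torsion module with
   Artinian y-kernel is Artinian. *)

(** * Linear algebra *)

Section LinearConstructions.
Context (R : pzRingType).
Implicit Types V W : lmodType R.

(** Subtracting two related pairs reduces uniqueness to the fibre over [0]. Maps between cohomology
    modules and inverse limits are built this way: a relation on representatives is visibly linear,
    while a choice of representatives is not. *)
Lemma linear_of_rel V W (P : V -> W -> Prop) :
  (forall a x x' y y', P x y -> P x' y' -> P (a *: x + x') (a *: y + y')) ->
  (forall x, exists y, P x y) -> (forall y, P 0 y -> y = 0) ->
  exists f : {linear V -> W}, forall x y, P x y <-> f x = y.
Proof.
move=> Plin Ptot Pfun.
pose f x := projT1 (cid (Ptot x)).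
have Pf x : P x (f x) by exact: projT2 (cid (Ptot x)).
have Puniq x y y' : P x y -> P x y' -> y = y'.
  move=> Py Py'; apply/subr0_eq/Pfun.
  by have := Plin (-1) _ _ _ _ Py' Py; rewrite !scaleN1r addNr addrC.
have fL : linear f by move=> a x y; apply: Puniq (Pf _) _; exact: Plin.
pose fM := GRing.isLinear.Build R V W *:%R f fL.
pose fl : {linear V -> W} := HB.pack f fM.
exists fl => x y; split=> [Pxy|<-]; last exact: Pf.
exact: Puniq (Pf x) Pxy.
Qed.

Definition pair_map V W (U : lmodType R) (f : V -> W) (g : V -> U) (x : V) : W * U :=
  (f x, g x).
Fact pair_map_is_linear V W (U : lmodType R) (f : {linear V -> W}) (g : {linear V -> U}) :
  linear (pair_map f g).
Proof. by move=> a x y; rewrite /pair_map !linearP. Qed.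
HB.instance Definition _ V W (U : lmodType R) (f : {linear V -> W}) (g : {linear V -> U}) :=
  GRing.isLinear.Build R V (W * U)%type *:%R (pair_map f g)
    (pair_map_is_linear f g).

(** Its image is the cyclic submodule generated by [x], and its kernel is the annihilator of [x]. *)
Definition smul_at V (x : V) (r : R^o) : V := (r : R) *: x.
Fact smul_at_is_linear V (x : V) : linear (smul_at x).
Proof. by move=> a r s; rewrite /smul_at scalerDl -scalerA. Qed.
HB.instance Definition _ V (x : V) :=
  GRing.isLinear.Build R R^o V *:%R (smul_at x) (smul_at_is_linear x).

Lemma submodN V (S : submod V) x : S x -> S (- x).
Proof. by move=> Sx; rewrite -scaleN1r; exact: submodZ. Qed.

Lemma span_incl V (A : set V) x : A x -> submod_span A x.
Proof. by move=> Ax S; apply. Qed.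

Lemma span1P V (x y : V) : submod_span [set` [:: x]] y <-> exists r : R, y = r *: x.
Proof.
split=> [/(_ (submod_im (smul_at x)))|[r ->]].
  case=> [z|r _ <-]; last by exists r.
  by rewrite /= inE => /eqP ->; exists 1 => //; exact: scale1r.
by apply/submodZ/span_incl; rewrite /= inE.
Qed.

Lemma span_consP V (x : V) s y : submod_span [set` x :: s] y <->
  exists2 r : R, True & exists2 z, submod_span [set` s] z & y = r *: x + z.
Proof.
split=> [/(_ (submod_add (submod_im (smul_at x)) (submod_span [set` s])))|].
  case=> [z|_ [r _ <-] [z sz <-]]; last by exists r => //; exists z.
  rewrite /= inE => /orP[/eqP ->|zs].
    exists x; first by exists 1 => //; exact: scale1r.
    by exists 0; [exact: (submod0 (submod_span _)) | exact: addr0].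
  exists 0; first by exists 0 => //; exact: scale0r.
  by exists z; [exact: (@span_incl _ [set` s]) | exact: add0r].
move=> [r _ [z sz ->]]; apply: submodL; first by apply: span_incl; rewrite /= inE eqxx.
by apply: sz => u us; apply: span_incl; rewrite /= inE us orbT.
Qed.

(** [W] is maximal among the submodules containing [P] whose intersection with [A] lies in [P]. The
    last clause is that maximality in terms of elements: adjoining [y] to [W] brings in an element
    of [A] outside [P]. When [P] lies in [A], it makes [V/W] an essential extension of [A/P]. *)
Lemma zorn_submod V (A P : submod V) : exists W : submod V,
  [/\ P `<=` W, forall x, W x -> A x -> P x &
      forall y, ~ W y -> exists r a, [/\ A a, ~ P a & W (r *: y - a)]].
Proof.
pose good (X : set V) := exists2 S : submod V, X = S :> set V &
  (forall x, P x -> S x) /\ (forall x, S x -> A x -> P x).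
pose adm (X : set V) := X = set0 \/ good X.
have adm_union (F : set (set V)) :
    F `<=` adm -> total_on F subset -> adm (\bigcup_(X in F) X).
  move=> Fadm Ftot.
  have [[X0 FX0 X0n]|none] := pselect (exists2 X, F X & X !=set0); last first.
    left; apply/seteqP; split=> // x [X FX Xx]; apply: none.
    by exists X => //; exists x.
  have Fgood X x : F X -> X x -> good X.
    by move=> FX Xx; have [X_0|//] := Fadm _ FX; rewrite X_0 in Xx.
  have [x0 X0x0] := X0n; have [S0 X0E [PS0 S0A]] := Fgood _ _ FX0 X0x0.
  pose U := \bigcup_(X in F) X.
  have U0 : U 0 by exists X0 => //; rewrite X0E; exact: submod0.
  have UL a x y : U x -> U y -> U (a *: x + y).
    move=> [X FX Xx] [Y FY Yy]; have [XY|YX] := Ftot _ _ FX FY.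
      have [S YE _] := Fgood _ _ FY Yy; exists Y => //.
      by move: (XY _ Xx) Yy; rewrite YE; exact: submodL.
    have [S XE _] := Fgood _ _ FX Xx; exists X => //.
    by move: Xx (YX _ Yy); rewrite XE; exact: submodL.
  right; exists (Submod U0 UL) => //; split=> x.
    by move=> Px; exists X0 => //; rewrite X0E; exact: PS0.
  by move=> [X FX Xx]; have [S XE [_ SA]] := Fgood _ _ FX Xx; apply: SA; rewrite -XE.
have [X [[X0|[W XE [PW WA]]] Xmax]] := Zorn_bigcup adm_union.
  have gP : adm (P : set V) by right; exists P.
  exfalso; apply: Xmax gP; rewrite X0; split=> //.
  by move=> /(_ 0); apply; exact: submod0.
exists W; split=> // y Wy; apply: contrapT => none.
pose W' := submod_add W (submod_im (smul_at y)).
have WW' x : W x -> W' x.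
  by move=> Wx; exists x => //; exists 0; [exists 0 => //; exact: scale0r | exact: addr0].
apply: (Xmax W'); last first.
  right; exists W' => //; split=> [x Px|x [w Ww [_ [r _ <-] <-]] Ax].
    exact/WW'/PW.
  apply: contrapT => nPx; apply: none; exists r, (w + smul_at y r); split=> //.
  by rewrite opprD addrCA subrr addr0; exact: submodN.
rewrite XE; split; first exact: WW'.
move=> W'W; apply: Wy; apply: W'W; exists 0; first exact: submod0.
by exists y; [exists 1 => //; exact: scale1r | exact: add0r].
Qed.

End LinearConstructions.

(** * Powers of ideals and Artin-Rees *)

Section IdealPowers.
Context (R : comNzRingType).
Implicit Types (a b c J : ideal R) (M V : lmodType R).

Lemma ideal_expM c n (x r : R) : c x -> ideal_exp c n r -> ideal_exp c n.+1 (x * r).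
Proof. by move=> cx cr; apply: span_incl; exists x => //; exists r. Qed.

Lemma ideal_exp1 c (r : R) : ideal_exp c 1 r -> c r.
Proof.
by apply=> _ [x cx [s _ <-]]; rewrite /GRing.scale /= mulrC; exact: (submodZ s cx).
Qed.

Lemma ideal_exp_sub a b n (r : R) : a `<=` b -> ideal_exp a n r -> ideal_exp b n r.
Proof.
move=> ab; elim: n r => // n IH r; apply=> _ [x ax [s bs <-]].
by apply: ideal_expM; [exact: ab | exact: IH].
Qed.

Lemma ideal_expX c n (x : R) : c x -> ideal_exp c n (x ^+ n).
Proof. by move=> cx; elim: n => // n IH; rewrite exprS; exact: ideal_expM. Qed.

Lemma ideal_exp_mulr c n (r s : R) : ideal_exp c n r -> ideal_exp c n (s * r).
Proof. by move=> cr; exact: (@submodZ _ _ (ideal_exp c n) s r). Qed.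

(** Induction on [k + l]. In a generator [(u + v) * s], the factor [s] is split with exponents
    [k - 1, l] for the term in [u] and with [k, l - 1] for the term in [v]. *)
Lemma ideal_exp_add a b k l (r : R) :
  ideal_exp (submod_add a b) (k + l) r ->
  submod_add (ideal_exp a k) (ideal_exp b l) r.
Proof.
have [n] := ubnP (k + l); elim: n => // n IH in k l r *.
case: k => [|k] kl.
  by move=> _; exists r => //; exists 0; [exact: submod0 | exact: addr0].
case: l => [|l] in kl *.
  by move=> _; exists 0; [exact: submod0 | exists r => //; exact: add0r].
rewrite addSn; apply=> _ [_ [u au [v bv <-]] [s abs <-]].
have -> : (u + v) *: s = u * s + v * s :> R by rewrite -mulrDl.
apply: submodD.
  have [p ap [q bq <-]] := IH k l.+1 s kl abs.
  rewrite mulrDr; exists (u * p); first exact: ideal_expM.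
  by exists (u * q) => //; exact: ideal_exp_mulr.
rewrite -addSnnS in kl; rewrite -addSnnS in abs.
have [p ap [q bq <-]] := IH k.+1 l s kl abs.
rewrite mulrDr; exists (v * p); first exact: ideal_exp_mulr.
by exists (v * q) => //; exact: ideal_expM.
Qed.

Lemma ideal_exp_span1 (x r : R) k :
  ideal_exp (submod_span [set` [:: x : R^o]]) k r -> exists s, r = s * x ^+ k.
Proof.
elim: k r => [|k IH] r; first by exists r; rewrite expr0 mulr1.
move=> /(_ (submod_im (@smul_at R R^o (x ^+ k.+1)))); case; last by move=> s _ <-; exists s.
move=> _ [_ /span1P [s ->] [t /IH [u ->] <-]]; exists (s * u) => //.
by change (s * u * x ^+ k.+1 = s * x * (u * x ^+ k)); rewrite exprS mulrACA.
Qed.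

(** One factor from [a] and one from [b] multiply into the intersection, so the factors are paired
    off one by one. *)
Lemma ideal_exp_mul a b n (r s : R) :
  ideal_exp a n r -> ideal_exp b n s -> ideal_exp (submod_cap a b) n (r * s).
Proof.
elim: n r s => // n IH r s ar bs.
have {}ar := ar (submod_preim (ideal_exp (submod_cap a b) n.+1)
  (@smul_at R R^o s)).
apply: ar => _ [x ax [r' ar' <-]] /=.
have {}bs := bs (submod_preim (ideal_exp (submod_cap a b) n.+1)
  (@smul_at R R^o (x * r'))).
rewrite /smul_at /GRing.scale /= mulrC; apply: bs => _ [y bys [s' bs' <-]] /=.
rewrite /smul_at /GRing.scale /=.
have -> : y * s' * (x * r') = (x * y) * (r' * s').
  by rewrite mulrACA [y * x]mulrC [s' * _]mulrC.
suff cxy : submod_cap a b (x * y).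
  exact: (ideal_expM cxy (IH _ _ ar' bs')).
split; first by rewrite mulrC; exact: (@submodZ _ _ a y x).
exact: (@submodZ _ _ b x y).
Qed.

Lemma adic_subP c M n (S : submod M) :
  (forall r y, ideal_exp c n r -> S (r *: y)) -> forall x, adic_sub c M n x -> S x.
Proof. by move=> cS x; apply=> _ [r cr [y _ <-]]; exact: cS. Qed.

Lemma adic_subZ c M n (r : R) (x : M) : ideal_exp c n r -> adic_sub c M n (r *: x).
Proof. by move=> cr; apply: span_incl; exists r => //; exists x. Qed.

Lemma adic_sub_antimono c M k n x : (k <= n)%N -> adic_sub c M n x -> adic_sub c M k x.
Proof.
by move=> kn; apply: adic_subP => r y cr; apply/adic_subZ/(ideal_exp_le kn).
Qed.

End IdealPowers.

(** * Ascending chains, essential extensions and the weak Artin-Rees lemma *)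

Section Noetherian.
Context (R : comNzRingType).
Implicit Types (c : ideal R) (V : lmodType R).

(** The chains live in [V] and are bounded by [D], so finitely generated submodules can be treated
    without becoming modules of their own. *)
Definition acc_on V (D : submod V) : Prop := forall S : nat -> submod V,
  (forall n x, S n x -> S n.+1 x) -> (forall n, S n `<=` D) ->
  exists N, forall n, S n `<=` S N.

Lemma chain_le V (S : nat -> submod V) : (forall n x, S n x -> S n.+1 x) ->
  forall k n x, (k <= n)%N -> S k x -> S n x.
Proof.
move=> Sinc k n x /subnK <- Sx; elim: (n - k)%N => // l IH.
by rewrite addSn; exact: Sinc.
Qed.

Context (R_noeth : noetherian R).

Lemma noetherian_acc : acc_on (submod_top R^o).
Proof.
move=> S Sinc _.
pose U : set R^o := [set x | exists n, S n x].
have U0 : U 0 by exists 0%N; exact: submod0.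
have UL a x y : U x -> U y -> U (a *: x + y).
  move=> [k Sx] [l Sy]; exists (maxn k l).
  apply: submodL; first exact: chain_le (leq_maxl _ _) Sx.
  exact: chain_le (leq_maxr _ _) Sy.
have [s sE] := R_noeth (Submod U0 UL).
have sU x : x \in s -> U x.
  by move=> xs; rewrite -[U]/(carrier (Submod U0 UL)) sE; exact: span_incl.
have [N SN] : exists N, forall x, x \in s -> S N x.
  elim: s {sE} sU => [|x s IH] sU; first by exists 0%N.
  have [|N SN] := IH; first by move=> y ys; apply: sU; rewrite inE ys orbT.
  have [k Sx] : U x by apply: sU; rewrite inE eqxx.
  exists (maxn k N) => y; rewrite inE => /orP[/eqP ->|/SN].
    exact: (chain_le Sinc (leq_maxl _ _)).
  exact: (chain_le Sinc (leq_maxr _ _)).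
exists N => n x Sx; have : carrier (Submod U0 UL) x by exists n.
by rewrite sE; apply=> y /= ys; exact: SN.
Qed.

(** Induction on the generators. With [D] spanned by the later ones, [S n] is controlled by [S n]
    intersected with [D] and by the ideal of those [r] with [r *: x] in [S n + D]; both chains
    stabilise. *)
Lemma acc_span V (s : seq V) : acc_on (submod_span [set` s]).
Proof.
elim: s => [|x s IH] S Sinc SD.
  exists 0%N => n y Sy; have := SD _ _ Sy; apply=> z; by rewrite /= inE.
pose D := submod_span [set` s].
have [N1 SN1] := IH (fun n => submod_cap (S n) D)
  (fun n y Sy => conj (Sinc _ _ Sy.1) Sy.2) (fun n y Sy => Sy.2).
have [N2 SN2] := noetherian_acc
  (S := fun n => submod_preim (submod_add (S n) D) (smul_at x))
  (fun n r Sr => let: ex_intro2 y Sy e := Sr in ex_intro2 _ _ y (Sinc _ _ Sy) e)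
  (fun n r _ => I).
exists (maxn N1 N2) => n y Sy.
have [r _ [z Dz yE]] := (span_consP _ _ _).1 (SD _ _ Sy).
have [|y' Sy' [z' Dz' rE]] := SN2 n r.
  exists y => //; exists (- z); last by rewrite yE addrK.
  exact: submodN.
have Sny' : S (maxn n N2) y' by exact: (chain_le Sinc (leq_maxr _ _)).
have Sny : S (maxn n N2) y by exact: (chain_le Sinc (leq_maxl _ _)).
have yy' : y - y' = z' + z.
  by rewrite yE -[r *: x]/(smul_at x r) -rE addrAC [y' + z']addrC addrK.
have [|/= SN1y _] := SN1 (maxn n N2) (y - y').
  by split; [exact: submodB | rewrite yy'; exact: submodD].
rewrite -(subrK y' y); apply: submodD.
  exact: (chain_le Sinc (leq_maxl _ _)).
exact: (chain_le Sinc (leq_maxr _ _)).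
Qed.

(** The submodules of those [y] in [D] with [x ^+ k *: y] in [W] stabilise at some [k]. If
    [x ^+ k *: y] is not in [W], a multiple of it agrees modulo [W] with some [z] in [A] outside
    [P]. A power of [x] sends [z] into [P], so by stability the multiple already lies in [W]; then
    so does [z], hence [z] is in [P]. *)
Lemma essential_nilpotent V (A P W D : submod V) (x : R) :
  acc_on D -> P `<=` W -> (forall y, W y -> A y -> P y) ->
  (forall y, ~ W y -> exists r a, [/\ A a, ~ P a & W (r *: y - a)]) ->
  (forall y, A y -> exists j, P (x ^+ j *: y)) ->
  exists k, forall y, D y -> W (x ^+ k *: y).
Proof.
move=> Dacc PW WA ess xA.
have [k y [Dy Wy]|k y []//|k Dk] := Dacc
  (fun k => submod_cap D (submod_preim W ( *:%R (x ^+ k) : {linear V -> V}))).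
  by split=> //; rewrite /= exprS -scalerA; exact: submodZ.
exists k => y Dy; apply: contrapT => /ess [r [z [Az Pz Wz]]]; apply: Pz.
have [j Pj] := xA _ Az.
have Drk : W (x ^+ (j + k) *: (r *: y)).
  have -> : x ^+ (j + k) *: (r *: y) =
      x ^+ j *: (r *: (x ^+ k *: y) - z) + x ^+ j *: z.
    by rewrite -scalerDr subrK !scalerA exprD mulrAC.
  by apply: submodD; [exact: submodZ | exact: PW].
have [|_ /= Wk] := Dk (j + k)%N (r *: y); first by split=> //; exact: submodZ.
apply: WA => //; rewrite -[z](subKr (r *: (x ^+ k *: y))); apply: submodB => //.
by rewrite scalerA mulrC -scalerA.
Qed.

(** Finitely many generators of [c] each have an exponent by the previous lemma, and [ideal_exp_add]
    combines these into a single power of [c]. *)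
Lemma essential_torsion V (c : ideal R) (A P W D : submod V) :
  acc_on D -> P `<=` W -> (forall y, W y -> A y -> P y) ->
  (forall y, ~ W y -> exists r a, [/\ A a, ~ P a & W (r *: y - a)]) ->
  (forall x y, c x -> A y -> exists j, P ((x : R) ^+ j *: y)) ->
  exists l, forall (r : R) y, ideal_exp c l r -> D y -> W (r *: y).
Proof.
move=> Dacc PW WA ess cA; have [s cE] := R_noeth c.
suff [l sl] : exists l, forall r y, ideal_exp (submod_span [set` s]) l r ->
    D y -> W ((r : R) *: y).
  by exists l => r y cr; apply: sl; apply: ideal_exp_sub cr; rewrite cE.
have : forall x, x \in s -> exists k, forall y, D y -> W ((x : R) ^+ k *: y).
  move=> x xs; apply: essential_nilpotent Dacc PW WA ess _ => y; apply: cA.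
  by rewrite cE; exact: span_incl.
elim: s {cE} => [_|x s IH sk].
  (* The exponent is one and not zero: the zeroth power of the zero ideal is the whole ring. *)
  exists 1%N => r y cr _; suff -> : r = 0 by rewrite scale0r; exact: submod0.
  have [|z ->] := @ideal_exp_span1 R 0 r 1; last by rewrite expr1 mulr0.
  by apply: ideal_exp_sub cr => z; apply=> w; rewrite /= inE.
have [|l sl] := IH; first by move=> z zs; apply: sk; rewrite inE zs orbT.
have [|k xk] := sk x; first by rewrite inE eqxx.
exists (k + l)%N => r y xs Dy.
have [|p xp [q sq <-]] := @ideal_exp_add R (submod_span [set` [:: x]])
  (submod_span [set` s]) k l r.
  apply: ideal_exp_sub xs => _ /span_consP [t _ [z sz ->]].
  by exists (t *: x); [apply/span1P; exists t | exists z].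
rewrite scalerDl; apply: submodD; last exact: sl.
by have [t ->] := ideal_exp_span1 xp; rewrite -scalerA; apply/submodZ/xk.
Qed.

(** Take [W] for [A = N] and [P = c^n N]. Each [x] in [c] satisfies [x^n N <= P], so some [c^l V]
    lies in [W], and [W] meets [N] inside [P]. *)
Lemma artin_rees V (c : ideal R) (N : submod V) n : acc_on (submod_top V) ->
  exists l, forall x, adic_sub c V l x -> N x -> ideal_mul (ideal_exp c n) N x.
Proof.
move=> Vacc; pose P := ideal_mul (ideal_exp c n) N.
have [W [PW WN ess]] := zorn_submod N P.
have [|l Wl] := essential_torsion (c := c) Vacc PW WN ess.
  move=> x y cx Ny; exists n; apply: span_incl; exists (x ^+ n); last by exists y.
  exact: ideal_expX.
exists l => x cx Nx; apply: WN => //.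
by move: cx; apply: adic_subP => r y cr; exact: Wl.
Qed.

End Noetherian.

(** * Cohomology classes and their representatives *)

Section Representatives.
Context (R : comNzRingType) (m : ideal R).
Implicit Types C D : complex R.

(** Coboundaries of the torsion subcomplex, described inside [C] itself: the primitive [y] has to be
    torsion as well. *)
Definition gamma_cob C n : C n -> Prop :=
  match n with
  | 0 => fun x => x = 0
  | k.+1 => fun x => exists2 y : C k, Gamma m (C k) y & cdiff C k y = x
  end.

(** Relates a class to the cocycles representing it, viewed in [C] instead of in nested subtypes of
    it, so that diagram chases use elements of [C]. *)
Definition rep C n (q : cohom (Gamma_cpx m C) n) (x : C n) : Prop :=
  exists (z : Gamma_cpx m C n) (hz : cocycles (Gamma_cpx m C) n z),
    q = qproj _ (insubm hz) /\ val z = x.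

Lemma rep_ex C n (q : cohom (Gamma_cpx m C) n) : exists x, rep q x.
Proof.
pose w := qrepr q; exists (val (val w)), (val w), (submod_valP w); split=> //.
by rewrite -[LHS]qreprK; congr qproj; exact: val_inj.
Qed.

Lemma rep_gamma C n (q : cohom (Gamma_cpx m C) n) x : rep q x -> Gamma m (C n) x.
Proof. by move=> [z [_ [_ <-]]]; exact: submod_valP. Qed.

Lemma rep_cocycle C n (q : cohom (Gamma_cpx m C) n) x : rep q x -> cdiff C n x = 0.
Proof. by move=> [z [/(congr1 val) dz [_ <-]]]. Qed.

Lemma rep_intro C n (x : C n) : Gamma m (C n) x -> cdiff C n x = 0 ->
  exists q : cohom (Gamma_cpx m C) n, rep q x.
Proof.
move=> Gx dx; have hz : cocycles (Gamma_cpx m C) n (insubm Gx) by exact: val_inj.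
by exists (qproj _ (insubm hz)), (insubm Gx), hz.
Qed.

Lemma rep_lin C n a (q q' : cohom (Gamma_cpx m C) n) x x' :
  rep q x -> rep q' x' -> rep (a *: q + q') (a *: x + x').
Proof.
move=> [z [hz [-> <-]]] [z' [hz' [-> <-]]].
exists (a *: z + z'), (submodL a hz hz'); split=> //.
by rewrite -linearP; congr qproj; exact: val_inj.
Qed.

Lemma rep_eq0 C n (q : cohom (Gamma_cpx m C) n) x :
  rep q x -> (q = 0 <-> gamma_cob x).
Proof.
move=> [z [hz [-> <-]]].
have -> : 0 = qproj (coboundaries_in (Gamma_cpx m C) n) 0 by rewrite linear0.
apply: (iff_trans (qproj_eq _ _ _)); rewrite subr0.
case: n z hz {q x} => [|n] z hz.
  by split=> [/(congr1 val)|zx]; [| exact: val_inj].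
split=> [[y _ /(congr1 val) yz]|[y Gy yz]].
  by exists (val y) => //; exact: submod_valP.
by exists (insubm Gy) => //; exact: val_inj.
Qed.

Lemma rep_map C D (phi : chain_map C D) n (q : cohom (Gamma_cpx m C) n) x :
  rep q x -> rep (cohom_map (Gamma_cmap m phi) n q) (phi n x).
Proof.
move=> [z [hz [-> <-]]].
exists (Gamma_cmap m phi n z), (cmap_cocycles (Gamma_cmap m phi) hz); split=> //.
rewrite [LHS](qmapE (@cmap_subproof _ _ _ (Gamma_cmap m phi) n)).
by congr qproj; exact: val_inj.
Qed.

Lemma rep0 C n : rep (0 : cohom (Gamma_cpx m C) n) 0.
Proof.
have [x qx] := rep_ex (0 : cohom (Gamma_cpx m C) n).
by have := rep_lin (-1) qx qx; rewrite !scaleN1r !addNr.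
Qed.

Lemma rep_inj C n (q q' : cohom (Gamma_cpx m C) n) x x' :
  rep q x -> rep q' x' -> gamma_cob (x - x') -> q = q'.
Proof.
move=> qx qx' xx'; apply/subr0_eq/(rep_eq0 _ (x := x - x')).2 => //.
by have := rep_lin (-1) qx' qx; rewrite !scaleN1r ![- _ + _]addrC.
Qed.

End Representatives.

(** * Lifting and homotopies *)

Section Lifting.
Context (R : pzRingType).

(** The recursion common to homotopies and connecting maps. The two vanishing conditions say that
    [F n (s n)] kills the kernel of the differential of [K]; it therefore factors through the image,
    and injectivity of [J n.+1] extends it to [K n.+1]. *)
Lemma extend_seq (C : lmodType R) (K : injres C) (J : nat -> lmodType R)
    (u : {linear C -> J 0}) (F : forall n, {linear K n -> J n} -> {linear K n -> J n.+1}) :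
  (forall n, injective_mod (J n)) ->
  (forall s : {linear K 0 -> J 0}, (forall c, s (aug K c) = u c) ->
    forall c, F 0 s (aug K c) = 0) ->
  (forall n (s : {linear K n -> J n}) (s' : {linear K n.+1 -> J n.+1}),
    (forall x, s' (cdiff K n x) = F n s x) ->
    forall x, F n.+1 s' (cdiff K n x) = 0) ->
  exists s : forall n, {linear K n -> J n}, (forall c, s 0 (aug K c) = u c) /\
    forall n x, s n.+1 (cdiff K n x) = F n (s n) x.
Proof.
move=> Jinj F0 FS.
have [s0 s0E] := @injective_factor _ _ _ (J 0) (aug K) u (Jinj 0)
  (fun x Kx => etrans (congr1 u (aug_inj (etrans Kx (esym (raddf0 _))))) (raddf0 u)).
(* Each map is carried together with the vanishing that makes the next extension possible. *)
pose good n (s : {linear K n -> J n}) := forall x, cdiff K n x = 0 -> F n s x = 0.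
have good0 : good 0 s0 by move=> x /aug_exact[c <-]; exact: F0.
have step n (s : {s | good n s}) :
  {s' : {s' | good n.+1 s'} | forall x, sval s' (cdiff K n x) = F n (sval s) x}.
  apply: cid; case: s => s gs /=.
  have [s' s'E] := @injective_factor _ _ _ (J n.+1) (cdiff K n) (F n s) (Jinj _) gs.
  have gs' : good n.+1 s' by move=> x /res_exact[y <-]; exact: FS s'E y.
  by exists (exist _ s' gs').
pose s := fix s n : {s | good n s} :=
  if n is k.+1 then sval (step k (s k)) else exist _ s0 good0.
by exists (fun n => sval (s n)); split=> // n x; exact: svalP (step n (s n)) x.
Qed.

(* The signs make [Phi] a chain map from [K] to the shift of [J]. *)
Lemma shifted_homotopy (C D : lmodType R) (K : injres C) (J : injres D)
    (Phi : forall n, {linear K n -> J n.+1}) (u : {linear C -> J 0}) :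
  (forall n x, Phi n.+1 (cdiff K n x) = - cdiff J n.+1 (Phi n x)) ->
  (forall c, Phi 0 (aug K c) = cdiff J 0 (u c)) ->
  exists s : forall n, {linear K n -> J n},
    forall n x, Phi n x = cdiff J n (s n x) - s n.+1 (cdiff K n x).
Proof.
move=> Phid Phi0.
have [s s0|n s s' s'E x|s [_ sE]] := @extend_seq C K J u
  (fun n s => (cdiff J n \o s) \- Phi n) (res_inj J).
- by move=> c /=; rewrite s0 Phi0 subrr.
- by rewrite /= s'E Phid /= linearB /= cdiffK sub0r opprK addNr.
- by exists s => n x; rewrite sE /= subKr.
Qed.

(** A chain map that vanishes on the augmented module is null-homotopic. *)
Lemma homotopy (C D : lmodType R) (K : injres C) (J : injres D)
    (phi : forall n, {linear K n -> J n}) :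
  (forall n x, phi n.+1 (cdiff K n x) = cdiff J n (phi n x)) ->
  (forall c, phi 0 (aug K c) = 0) ->
  exists s : forall n, {linear K n.+1 -> J n},
    (forall x, phi 0 x = s 0 (cdiff K 0 x)) /\
    forall n x, phi n.+1 x = s n.+1 (cdiff K n.+1 x) + cdiff J n (s n x).
Proof.
move=> phid phi0.
(* A homotopy lowers the degree by one, so the target is shifted, with the zero module put in degree
   0. *)
pose J' n : lmodType R := if n is k.+1 then J k else 'rV[R]_0.
have J'inj n : injective_mod (J' n).
  case: n => [|n]; last exact: res_inj.
  by move=> A B f g _; exists \0 => x; rewrite [LHS]thinmx0 [RHS]thinmx0.
pose F n : {linear K n -> J' n} -> {linear K n -> J' n.+1} :=
  match n with
  | 0 => fun _ => phi 0
  | k.+1 => fun s : {linear K k.+1 -> J k} => phi k.+1 \- (cdiff J k \o s)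
  end.
have [s _ c|n s s' s'E x|s [_ sE]] := @extend_seq C K J' \0 F J'inj.
- exact: phi0.
- case: n s s' s'E x => [|n] s s' s'E x /=; first by rewrite s'E /= phid subrr.
  by rewrite s'E /= phid linearB /= cdiffK subr0 subrr.
- exists (fun n => s n.+1); split=> [x|n x]; first by rewrite sE.
  by rewrite (sE n.+1) /= subrK.
Qed.

End Lifting.

(** * Functoriality and additivity of local cohomology *)

Section Functoriality.
Context (R : comNzRingType) (m : ideal R).
Implicit Types C D : complex R.

Lemma rep_fun C n (q q' : cohom (Gamma_cpx m C) n) x : rep q x -> rep q' x -> q = q'.
Proof.
move=> qx q'x; apply: (rep_inj qx q'x); rewrite subrr.
by apply/(rep_eq0 (rep0 m C n)).
Qed.

Lemma gamma_cob_cdiff C n (y : C n) : Gamma m (C n) y ->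
  gamma_cob m (C := C) (n := n.+1) (cdiff C n y).
Proof. by move=> Gy; exists y. Qed.

(** The difference of the chain maps is null-homotopic, and the homotopy preserves torsion elements
    because it is linear. On a cocycle only the term [d s] survives; in degree 0 nothing does. *)
Lemma cohom_map_eq (M N : lmodType R) (I : injres M) (J : injres N)
    (phi psi : chain_map I J) :
  (forall x, phi 0 (aug I x) = psi 0 (aug I x)) ->
  forall n q, cohom_map (Gamma_cmap m phi) n q = cohom_map (Gamma_cmap m psi) n q.
Proof.
move=> aug_eq n q.
have [|c|s [s0 sE]] := @homotopy _ _ _ I J (fun n => phi n \- psi n).
- by move=> k x; rewrite /= !cmapP linearB.
- by rewrite /= aug_eq subrr.
have [x qx] := rep_ex q; apply: (rep_inj (rep_map phi qx) (rep_map psi qx)).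
have dx := rep_cocycle qx; have Gx := rep_gamma qx.
case: n q x qx dx Gx => [|n] q x _ dx Gx.
  by have := s0 x; rewrite dx linear0.
have := sE n x; rewrite dx linear0 add0r /= => ->.
exact/gamma_cob_cdiff/Gamma_map.
Qed.

Definition id_cmap C : chain_map C C := @ChainMap R C C (fun n => idfun) (fun n x => erefl).

Definition comp_cmap C D (E : complex R) (psi : chain_map D E) (phi : chain_map C D) :
  chain_map C E.
Proof.
by exists (fun n => psi n \o phi n) => n x; rewrite /= !cmapP.
Defined.

Definition lin_cmap C D (a : R) (phi psi : chain_map C D) : chain_map C D.
Proof.
by exists (fun n => (a \*: phi n) \+ psi n) => n x; rewrite /= !cmapP linearP.
Defined.

Lemma cohom_map_comp C D (E : complex R) (psi : chain_map D E) (phi : chain_map C D) n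
    (q : cohom (Gamma_cpx m C) n) :
  cohom_map (Gamma_cmap m (comp_cmap psi phi)) n q =
  cohom_map (Gamma_cmap m psi) n (cohom_map (Gamma_cmap m phi) n q).
Proof.
have [x qx] := rep_ex q; apply: (rep_fun (rep_map (comp_cmap psi phi) qx)).
exact: rep_map (rep_map phi qx).
Qed.

Lemma cohom_map_id C n (q : cohom (Gamma_cpx m C) n) :
  cohom_map (Gamma_cmap m (id_cmap C)) n q = q.
Proof. by have [x qx] := rep_ex q; exact: (rep_fun (rep_map (id_cmap C) qx) qx). Qed.

Lemma cohom_map_lin C D (a : R) (phi psi : chain_map C D) n
    (q : cohom (Gamma_cpx m C) n) :
  cohom_map (Gamma_cmap m (lin_cmap a phi psi)) n q =
  a *: cohom_map (Gamma_cmap m phi) n q + cohom_map (Gamma_cmap m psi) n q.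
Proof.
have [x qx] := rep_ex q; apply: (rep_fun (rep_map (lin_cmap a phi psi) qx)).
exact: rep_lin (rep_map phi qx) (rep_map psi qx).
Qed.

Lemma cohom_map_triangle (M N L : lmodType R) (I : injres M) (J : injres N)
    (E : injres L) (phi : chain_map I J) (psi : chain_map J E) (chi : chain_map I E) :
  (forall x, chi 0 (aug I x) = psi 0 (phi 0 (aug I x))) ->
  forall n q, cohom_map (Gamma_cmap m chi) n q =
    cohom_map (Gamma_cmap m psi) n (cohom_map (Gamma_cmap m phi) n q).
Proof.
move=> chiE n q; rewrite (@cohom_map_eq M L I E chi (comp_cmap psi phi)) //.
exact: cohom_map_comp.
Qed.

(** Used in both directions, it identifies the cohomology computed from two resolutions of the same
    module. *)
Lemma cohom_map_retract (M N : lmodType R) (I : injres M) (J : injres N)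
    (phi : chain_map I J) (psi : chain_map J I) :
  (forall x, psi 0 (phi 0 (aug I x)) = aug I x) ->
  forall n q, cohom_map (Gamma_cmap m psi) n (cohom_map (Gamma_cmap m phi) n q) = q.
Proof.
move=> psiK n q; rewrite -(@cohom_map_triangle M N M I J I phi psi (id_cmap I)).
  exact: cohom_map_id.
by move=> x; rewrite psiK.
Qed.

Implicit Types M N L : lmodType R.

(** Allows the chosen lift to be replaced by any convenient chain map over [f]. *)
Lemma loccoh_map_lift n M N (f : {linear M -> N}) (phi : chain_map (res M) (res N)) :
  (forall x, phi 0 (aug (res M) x) = aug (res N) (f x)) ->
  forall q, loccoh_map m (Posz n) f q = cohom_map (Gamma_cmap m phi) n q.
Proof. by move=> phi0 q; apply: cohom_map_eq => x; rewrite liftP phi0. Qed.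

Lemma loccoh_map_id i M (f : {linear M -> M}) :
  (forall x, f x = x) -> forall q, loccoh_map m i f q = q.
Proof.
case: i => [n|//] fE q; rewrite (@loccoh_map_lift n M M f (id_cmap _)).
  exact: cohom_map_id.
by move=> x; rewrite fE.
Qed.

Lemma loccoh_map_comp i M N L (f : {linear M -> N}) (g : {linear N -> L})
    (h : {linear M -> L}) : (forall x, h x = g (f x)) ->
  forall q, loccoh_map m i h q = loccoh_map m i g (loccoh_map m i f q).
Proof.
case: i => [n|//] hE q.
rewrite (@loccoh_map_lift n M L h (comp_cmap (Defs.lift (res N) (res L) g) (Defs.lift (res M) (res N) f))).
  exact: cohom_map_comp.
by move=> x; rewrite /= !liftP hE.
Qed.

Lemma loccoh_neg i M (x y : loccoh m (Negz i) M) : x = y.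
Proof. by rewrite [x]thinmx0 [y]thinmx0. Qed.

Lemma loccoh_map_lin i M N a (f g h : {linear M -> N}) :
  (forall x, h x = a *: f x + g x) ->
  forall q, loccoh_map m i h q = a *: loccoh_map m i f q + loccoh_map m i g q.
Proof.
case: i => [n|n] hE q; last exact: loccoh_neg.
rewrite (@loccoh_map_lift n M N h (lin_cmap a (Defs.lift (res M) (res N) f) (Defs.lift (res M) (res N) g))).
  exact: cohom_map_lin.
by move=> x; rewrite /= !liftP hE linearP.
Qed.

Lemma loccoh_map0 i M N (f : {linear M -> N}) :
  (forall x, f x = 0) -> forall q, loccoh_map m i f q = 0.
Proof.
(* A zero map satisfies [f = - f + f], so linearity forces the induced map to vanish. *)
move=> f0 q; rewrite (@loccoh_map_lin i M N (-1) f f) ?scaleN1r ?addNr// => x.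
by rewrite f0 scaler0 addr0.
Qed.

End Functoriality.

(** * The long exact sequence *)

Definition short_exact (R : pzRingType) (A B C : lmodType R)
    (f : {linear A -> B}) (g : {linear B -> C}) : Prop :=
  [/\ injective f, exact_at f g & forall c, exists b, g b = c].

Section Connecting.
Context (R : comNzRingType) (m : ideal R) (A B C : lmodType R).
Context (f : {linear A -> B}) (g : {linear B -> C}) (fg : short_exact f g).
Context (I : injres A) (K : injres C).

Lemma ses_comp0 x : g (f x) = 0.
Proof. by have [_ fgx _] := fg; apply/fgx; exists x. Qed.

(** The data for a resolution of [B] built from [I] and [K]: [h] is one component of its
    augmentation, and [T] is the off-diagonal term of the differential
    [(x, y) |-> (d x - T y, d y)]. The sign makes this square to zero. *)
Definition connecting (h : {linear B -> I 0}) (T : forall n, {linear K n -> I n.+1}) :=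
  [/\ forall x, h (f x) = aug I x, forall x, T 0 (aug K (g x)) = cdiff I 0 (h x) &
      forall n y, T n.+1 (cdiff K n y) = - cdiff I n.+1 (T n y)].

(** Extend the augmentation of [I] along [f] to [h]. Then [d h] kills the image of [f], so it
    descends to a map [t] from [C], which is continued along [K]. *)
Lemma connecting_ex : exists h T, connecting h T.
Proof.
have [f_inj fgx g_surj] := fg.
have [h hf] := res_inj I 0 _ _ f (aug I) f_inj.
have [x gx0|t tg] := @injective_factor _ _ _ (I 1) g (cdiff I 0 \o h) (res_inj I 1).
  by have [y <-] := (fgx x).1 gx0; rewrite /= hf; apply/aug_exact; exists y.
have [s s0 c|n s s' s'E x|T [T0 TS]] := @extend_seq R C K (fun n => I n.+1) t
  (fun n s => -%R \o (cdiff I n.+1 \o s)) (fun n => res_inj I n.+1).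
- by have [b <-] := g_surj c; rewrite /= s0 tg /= cdiffK oppr0.
- by rewrite /= s'E /= raddfN /= cdiffK oppr0 oppr0.
- by exists h, T; split=> // x; rewrite T0 tg.
Qed.

Context (h : {linear B -> I 0}) (T : forall n, {linear K n -> I n.+1}).
Hypothesis hT : connecting h T.

Lemma connecting_aug x : h (f x) = aug I x.
Proof. by have [-> _ _] := hT. Qed.

Lemma connecting_map n : exists delta :
    {linear cohom (Gamma_cpx m K) n -> cohom (Gamma_cpx m I) n.+1},
  forall q y, rep q y -> rep (delta q) (T n y).
Proof.
have [_ _ TS] := hT.
pose P (q : cohom (Gamma_cpx m K) n) (q' : cohom (Gamma_cpx m I) n.+1) :=
  exists2 y, rep q y & rep q' (T n y).
have [a q q' p p' [y qy py] [y' qy' py']|q|p [y qy py]|delta dP] := @linear_of_rel _ _ _ P.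
- exists (a *: y + y'); first exact: rep_lin.
  by rewrite linearP; exact: rep_lin.
- have [y qy] := rep_ex q.
  have [||p py] := @rep_intro _ m I n.+1 (T n y); last by exists p, y.
    exact/Gamma_map/(rep_gamma qy).
  by apply: oppr_inj; rewrite -TS (rep_cocycle qy) linear0 oppr0.
- apply/(rep_eq0 py); have := (rep_eq0 qy).1 erefl.
  case: n y {qy py P p} => [|n] y; first by move=> ->; exists 0; rewrite ?linear0//; exact: submod0.
  move=> [z Gz <-]; rewrite TS -linearN; apply: gamma_cob_cdiff.
  exact/submodN/Gamma_map.
- exists delta => q y qy; have [y' qy' dq] := (dP q _).2 erefl.
  have [||p py] := @rep_intro _ m I n.+1 (T n y).
    exact/Gamma_map/(rep_gamma qy).
    by apply: oppr_inj; rewrite -TS (rep_cocycle qy) linear0 oppr0.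
  by have -> : delta q = p by apply/(dP q p).1; exists y.
Qed.

(* The mapping cocone of [T]: a resolution of [B] that is degreewise a direct
   sum of those of [A] and [C]. *)
Definition cocone_obj n : lmodType R := (I n * K n)%type.
Definition cocone_diff n : {linear cocone_obj n -> cocone_obj n.+1} :=
  pair_map ((cdiff I n \o fst) \- (T n \o snd)) (cdiff K n \o snd).

Fact cocone_diffK n x : cocone_diff n.+1 (cocone_diff n x) = 0.
Proof.
have [_ _ TS] := hT; case: x => x y; congr (_, _) => /=; last exact: cdiffK.
by rewrite linearB /= cdiffK TS sub0r opprK addNr.
Qed.

Definition cocone_cpx : complex R := Complex cocone_diffK.
Definition cocone_aug : {linear B -> cocone_obj 0} := pair_map h (aug K \o g).

Fact cocone_inj n : injective_mod (cocone_cpx n).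
Proof.
move=> X Y i j i_inj.
have [u uE] := res_inj I n _ _ i (fst \o j) i_inj.
have [v vE] := res_inj K n _ _ i (snd \o j) i_inj.
by exists (pair_map u v) => x; rewrite -[LHS]/(u (i x), v (i x)) uE vE /=; case: (j x).
Qed.

Fact cocone_aug_inj : injective cocone_aug.
Proof.
have [hf _ _] := hT; have [_ fgx _] := fg.
apply: raddf_inj => x [hx /=]; rewrite -(raddf0 (aug K)) => /aug_inj /fgx [y yx].
by move: hx; rewrite -yx hf -(raddf0 (aug I)) => /aug_inj ->; rewrite linear0.
Qed.

(** For a cocycle [(x, y)], write [y] as the augmentation of [c] and lift [c] to [b]. Then [x - h b]
    is a cocycle of [I], hence comes from some [a], and [b + f a] is the preimage. *)
Fact cocone_aug_exact x : cdiff cocone_cpx 0 x = 0 <-> exists y, cocone_aug y = x.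
Proof.
have [hf T0 _] := hT; have [_ _ g_surj] := fg.
split=> [|[b <-]]; last first.
  congr (_, _) => /=; first by rewrite T0 subrr.
  by apply/aug_exact; exists (g b).
case: x => x y [/= dx /aug_exact [c cy]]; have [b bc] := g_surj c.
have [a ax] : exists a, aug I a = x - h b.
  by apply/aug_exact; rewrite linearB -T0 bc cy.
exists (b + f a); congr (_, _); first by rewrite linearD hf ax addrC subrK.
by rewrite /= [g _]linearD ses_comp0 addr0 bc.
Qed.

Fact cocone_exact n x :
  cdiff cocone_cpx n.+1 x = 0 <-> exists y, cdiff cocone_cpx n y = x.
Proof.
have [_ _ TS] := hT; split=> [|[y <-]]; last exact: cocone_diffK.
case: x => x y [/= dx /res_exact [y' yE]].
have [x' xE] : exists x', cdiff I n x' = x + T n y'.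
  by apply/res_exact; rewrite linearD -[cdiff _ _ (T _ _)]opprK -TS yE.
by exists (x', y'); congr (_, _) => //=; rewrite xE addrK.
Qed.

Definition cocone : injres B :=
  @InjRes R B cocone_cpx cocone_aug cocone_inj cocone_aug_inj cocone_aug_exact cocone_exact.

Definition cocone_in : chain_map I cocone.
Proof.
exists (fun n => pair_map idfun \0 : {linear I n -> cocone n}) => n x.
apply: (congr2 pair); first by rewrite /= linear0 subr0.
by rewrite /= linear0.
Defined.

Definition cocone_out : chain_map cocone K.
Proof. by exists (fun n => snd : {linear cocone n -> K n}). Defined.

Lemma Gamma_pair (V W : lmodType R) (x : V) (y : W) :
  Gamma m V x -> Gamma m W y -> Gamma m (V * W)%type (x, y).
Proof.
move=> [k xk] [l yl]; exists (maxn k l) => r mr; apply: (congr2 pair).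
  by apply: xk; apply: ideal_exp_le mr; exact: leq_maxl.
by apply: yl; apply: ideal_exp_le mr; exact: leq_maxr.
Qed.

(** If [y = d z] with [z] torsion, subtracting the coboundary [d (0, z)] turns [(x, y)] into
    [(x + T z, 0)], which comes from [I]. *)
Lemma cocone_exact_mid n (p : cohom (Gamma_cpx m cocone) n) :
  cohom_map (Gamma_cmap m cocone_out) n p = 0 ->
  exists q, cohom_map (Gamma_cmap m cocone_in) n q = p.
Proof.
have [_ _ TS] := hT; have [[x y] pxy] := rep_ex p.
move=> /(rep_eq0 (rep_map cocone_out pxy)) /= ycob.
have Gx : Gamma m (I n) x := Gamma_map fst (rep_gamma pxy).
have [] := rep_cocycle pxy.
case: n p x y pxy ycob Gx => [|n] p x y pxy /= ycob Gx /= dx dy.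
  have [|q qx] := rep_intro Gx; first by rewrite -dx ycob linear0 subr0.
  by rewrite ycob in pxy; exists q; exact: rep_fun (rep_map cocone_in qx) pxy.
have [z Gz zE] := ycob.
have [||q qx] := @rep_intro _ m I n.+1 (x + T n z).
- by apply: submodD => //; exact: Gamma_map.
- by rewrite linearD -[cdiff _ _ (T _ _)]opprK -TS zE.
exists q; apply: rep_inj (rep_map cocone_in qx) pxy _.
have -> : cocone_in n.+1 (x + T n z) - (x, y) = cdiff cocone n (0, - z).
  apply: (congr2 pair) => /=; first by rewrite linear0 sub0r linearN opprK addrAC subrr add0r.
  by rewrite linearN zE sub0r.
apply: gamma_cob_cdiff; apply: Gamma_pair; first exact: submod0.
exact: submodN.
Qed.

Context (n : nat) (delta : {linear cohom (Gamma_cpx m K) n -> cohom (Gamma_cpx m I) n.+1}).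
Hypothesis deltaE : forall q y, rep q y -> rep (delta q) (T n y).

(** For a cocycle [y], the equation [T y = d x] says exactly that [(x, y)] is a cocycle of the
    cocone. *)
Lemma cocone_exact_right q :
  delta q = 0 <-> exists p, cohom_map (Gamma_cmap m cocone_out) n p = q.
Proof.
split=> [|[p <-]].
  have [y qy] := rep_ex q; move=> /(rep_eq0 (deltaE qy)) [x Gx xE].
  have [||p pxy] := @rep_intro _ m cocone n (x, y).
  - by apply: Gamma_pair => //; exact: rep_gamma qy.
  - by apply: (congr2 pair) => /=; [rewrite xE subrr | exact: rep_cocycle qy].
  by exists p; exact: rep_fun (rep_map cocone_out pxy) qy.
have [[x y] pxy] := rep_ex p.
have Gx : Gamma m (I n) x := Gamma_map fst (rep_gamma pxy).
apply/(rep_eq0 (deltaE (rep_map cocone_out pxy))); exists x => //.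
by have [/= /subr0_eq] := rep_cocycle pxy.
Qed.

Lemma cocone_exact_left p :
  cohom_map (Gamma_cmap m cocone_in) n.+1 p = 0 <-> exists q, delta q = p.
Proof.
split=> [|[q <-]].
  have [x px] := rep_ex p; move=> /(rep_eq0 (rep_map cocone_in px)) [[x' y'] Gxy [/= xE yE]].
  have Gx' : Gamma m (I n) x' := Gamma_map fst Gxy.
  have Gy' : Gamma m (K n) y' := Gamma_map snd Gxy.
  (* From [(x, 0) = d (x', y')] one gets [x = d x' - T y'], so the class of [x] is the image of
     minus the class of [y']. *)
  have [q qy] := rep_intro Gy' yE; exists (- q).
  rewrite linearN; have := rep_lin (-1) (deltaE qy) (rep0 m I n.+1).
  rewrite !scaleN1r !addr0 => dq; apply: (rep_inj dq px).
  have -> : - T n y' - x = - cdiff I n x' by rewrite -xE opprB addrA addNr add0r.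
  rewrite -linearN; apply: gamma_cob_cdiff.
  exact: submodN.
have [y qy] := rep_ex q; apply/(rep_eq0 (rep_map cocone_in (deltaE qy))).
exists (0, - y).
  apply: Gamma_pair; first exact: submod0.
  exact/submodN/(rep_gamma qy).
by apply: (congr2 pair); rewrite /= ?linear0 ?sub0r linearN ?opprK ?(rep_cocycle qy) ?oppr0.
Qed.

Lemma cocone_exact0 q : cohom_map (Gamma_cmap m cocone_in) 0 q = 0 -> q = 0.
Proof.
have [x qx] := rep_ex q; move=> /(rep_eq0 (rep_map cocone_in qx)) [/= x0].
exact/(rep_eq0 qx).
Qed.

End Connecting.

(** * Naturality of the connecting map, and exactness for the chosen resolutions *)

Section Naturality.
Context (R : comNzRingType) (m : ideal R).

(** The map [h' be - phi h] vanishes on the image of [f] and so descends to [u] on [C]. The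
    difference [T' psi - phi T] lies over [d u], hence is null-homotopic up to the shift, and sends
    torsion cocycles to torsion coboundaries. *)
Lemma connecting_nat (A B C A' B' C' : lmodType R)
    (f : {linear A -> B}) (g : {linear B -> C}) (fg : short_exact f g)
    (f' : {linear A' -> B'}) (g' : {linear B' -> C'})
    (al : {linear A -> A'}) (be : {linear B -> B'}) (ga : {linear C -> C'})
    (I : injres A) (K : injres C) (I' : injres A') (K' : injres C')
    h T h' T' (phi : chain_map I I') (psi : chain_map K K') :
  (forall x, be (f x) = f' (al x)) -> (forall x, ga (g x) = g' (be x)) ->
  (forall x, phi 0 (aug I x) = aug I' (al x)) ->
  (forall x, psi 0 (aug K x) = aug K' (ga x)) ->
  connecting f g (I := I) (K := K) h T -> connecting f' g' (I := I') (K := K') h' T' ->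
  forall n (delta : {linear cohom (Gamma_cpx m K) n -> cohom (Gamma_cpx m I) n.+1})
    (delta' : {linear cohom (Gamma_cpx m K') n -> cohom (Gamma_cpx m I') n.+1}),
  (forall q y, rep q y -> rep (delta q) (T n y)) ->
  (forall q y, rep q y -> rep (delta' q) (T' n y)) ->
  forall q, delta' (cohom_map (Gamma_cmap m psi) n q) =
    cohom_map (Gamma_cmap m phi) n.+1 (delta q).
Proof.
move=> bf gb phi0 psi0 [hf T0 TS] [hf' T0' TS'] n delta delta' dE dE' q.
have [f_inj fgx g_surj] := fg.
have [x gx0|u uE] := @injective_factor _ _ _ (I' 0) g ((h' \o be) \- (phi 0 \o h)) (res_inj I' 0).
  have [y <-] := (fgx x).1 gx0.
  by rewrite /= bf hf' hf phi0 subrr.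
have [k x|c|s sE] := @shifted_homotopy R C A' K I'
  (fun n => (T' n \o psi n) \- (phi n.+1 \o T n)) u.
- by rewrite /= cmapP TS' TS !linearN linearB /= opprB opprK -cmapP addrC.
- have [b <-] := g_surj c.
  by rewrite uE /= psi0 gb T0' T0 cmapP -linearB.
have [y qy] := rep_ex q.
apply: (rep_inj (dE' _ _ (rep_map psi qy)) (rep_map phi (dE _ _ qy))).
have := sE n y; rewrite (rep_cocycle qy) linear0 subr0 /= => ->.
exact/gamma_cob_cdiff/Gamma_map/(rep_gamma qy).
Qed.

Context (A B C : lmodType R) (f : {linear A -> B}) (g : {linear B -> C}).
Context (fg : short_exact f g).

(** The comparison maps [u] and [v] replace the chosen resolution of [B] by the cocone. Under them
    [f] and [g] become the inclusion of [I] and the projection to [K]. *)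
Lemma loccoh_les n h T (delta : {linear loccoh m (Posz n) C -> loccoh m (Posz n.+1) A}) :
  connecting f g (I := res A) (K := res C) h T ->
  (forall (q : cohom (Gamma_cpx m (res C)) n) y, rep q y ->
    rep (delta q : cohom (Gamma_cpx m (res A)) n.+1) (T n y)) ->
  [/\ exact_at (loccoh_map m (Posz n) f) (loccoh_map m (Posz n) g),
      exact_at (loccoh_map m (Posz n) g) delta,
      exact_at delta (loccoh_map m (Posz n.+1) f) &
      forall q, loccoh_map m (Posz 0) f q = 0 -> q = 0].
Proof.
move=> hT dE.
pose J := cocone fg hT.
pose u := Defs.lift (res B) J idfun; pose v := Defs.lift J (res B) idfun.
have vu k (q : cohom (Gamma_cpx m (res B)) k) :
    cohom_map (Gamma_cmap m v) k (cohom_map (Gamma_cmap m u) k q) = q.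
  by apply: cohom_map_retract => x; rewrite !liftP.
have uv k (q : cohom (Gamma_cpx m J) k) :
    cohom_map (Gamma_cmap m u) k (cohom_map (Gamma_cmap m v) k q) = q.
  by apply: cohom_map_retract => x; rewrite !liftP.
pose i := cocone_in fg hT; pose o := cocone_out fg hT.
have fE k (q : cohom (Gamma_cpx m (res A)) k) : loccoh_map m (Posz k) f q =
    cohom_map (Gamma_cmap m v) k (cohom_map (Gamma_cmap m i) k q).
  apply: cohom_map_triangle => x; rewrite liftP -[RHS]/(v 0 _).
  have -> : i 0 (aug (res A) x) = aug J (f x).
    apply: (congr2 pair); first exact: esym (connecting_aug hT x).
    by rewrite /= (ses_comp0 fg) raddf0.
  by rewrite liftP.
have gE k (q : cohom (Gamma_cpx m (res B)) k) : loccoh_map m (Posz k) g q =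
    cohom_map (Gamma_cmap m o) k (cohom_map (Gamma_cmap m u) k q).
  by apply: cohom_map_triangle => x; rewrite !liftP.
split.
- move=> q; split=> [|[p <-]]; last first.
    rewrite -(@loccoh_map_comp _ m _ _ _ _ f g (g \o f)) //.
    by apply: loccoh_map0 => x; exact: (ses_comp0 fg).
  rewrite gE => /cocone_exact_mid [p pE]; exists p.
  by rewrite fE pE vu.
- move=> q; apply: (iff_trans (cocone_exact_right fg hT dE q)).
  split=> [[p pE]|[p pE]]; last first.
    by exists (cohom_map (Gamma_cmap m u) n p); rewrite -pE gE.
  by exists (cohom_map (Gamma_cmap m v) n p); rewrite gE uv.
- move=> q; apply: (iff_trans _ (cocone_exact_left fg hT dE q)).
  rewrite fE; split=> [qE|->]; last by rewrite linear0.
  by rewrite -[LHS]uv qE linear0.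
- move=> q; rewrite fE => qE; apply: (cocone_exact0 (fg := fg) (hT := hT)).
  by rewrite -[LHS]uv qE linear0.
Qed.

End Naturality.

(** * The long exact sequence of a system of short exact sequences *)

Section LongExactSequence.
Context (R : comNzRingType) (m : ideal R).

(** Remembers how [delta] arises from [h] and [T], which is what the naturality argument works
    with. *)
Definition is_delta (A B C : lmodType R) (f : {linear A -> B}) (g : {linear B -> C}) n
    (delta : {linear loccoh m (Posz n) C -> loccoh m (Posz n.+1) A}) : Prop :=
  exists h T, connecting f g (I := res A) (K := res C) h T /\
    forall (q : cohom (Gamma_cpx m (res C)) n) y, rep q y ->
      rep (delta q : cohom (Gamma_cpx m (res A)) n.+1) (T n y).

Lemma is_delta_ex (A B C : lmodType R) (f : {linear A -> B}) (g : {linear B -> C}) n :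
  short_exact f g -> exists delta, is_delta f g (n := n) delta.
Proof.
move=> fg; have [h [T hT]] := connecting_ex fg (res A) (res C).
have [delta dE] := connecting_map m hT n.
by exists delta, h, T.
Qed.

Lemma is_delta_exact (A B C : lmodType R) (f : {linear A -> B}) (g : {linear B -> C}) n
    delta : short_exact f g -> is_delta f g (n := n) delta ->
  [/\ exact_at (loccoh_map m (Posz n) f) (loccoh_map m (Posz n) g),
      exact_at (loccoh_map m (Posz n) g) delta,
      exact_at delta (loccoh_map m (Posz n.+1) f) &
      forall q, loccoh_map m (Posz 0) f q = 0 -> q = 0].
Proof. by move=> fg [h [T [hT dE]]]; exact: (loccoh_les fg hT dE). Qed.

Lemma is_delta_nat (A B C A' B' C' : lmodType R)
    (f : {linear A -> B}) (g : {linear B -> C})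
    (f' : {linear A' -> B'}) (g' : {linear B' -> C'})
    (al : {linear A -> A'}) (be : {linear B -> B'}) (ga : {linear C -> C'})
    n delta delta' :
  short_exact f g ->
  (forall x, be (f x) = f' (al x)) -> (forall x, ga (g x) = g' (be x)) ->
  is_delta f g (n := n) delta -> is_delta f' g' (n := n) delta' ->
  forall q, delta' (loccoh_map m (Posz n) ga q) = loccoh_map m (Posz n.+1) al (delta q).
Proof.
move=> fg bf gb [h [T [hT dE]]] [h' [T' [hT' dE']]].
apply: (connecting_nat fg bf gb _ _ hT hT' dE dE'); exact: liftP.
Qed.

(* The group in degree -1 is zero, so the case [i = -1] says that the sequence
   starts with an injection. *)
Lemma long_exact_system (A B C : nat -> lmodType R)
    (f : forall k, {linear A k -> B k}) (g : forall k, {linear B k -> C k})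
    (al : forall k, {linear A k.+1 -> A k}) (be : forall k, {linear B k.+1 -> B k})
    (ga : forall k, {linear C k.+1 -> C k}) (i j : int) :
  (forall k, short_exact (f k) (g k)) ->
  (forall k x, be k (f k.+1 x) = f k (al k x)) ->
  (forall k x, ga k (g k.+1 x) = g k (be k x)) -> j = i + 1 ->
  exists delta : forall k, {linear loccoh m i (C k) -> loccoh m j (A k)}, forall k,
    [/\ exact_at (loccoh_map m i (f k)) (loccoh_map m i (g k)),
        exact_at (loccoh_map m i (g k)) (delta k),
        exact_at (delta k) (loccoh_map m j (f k)) &
        forall q, delta k (loccoh_map m i (ga k) q) = loccoh_map m j (al k) (delta k.+1 q)].
Proof.
move=> fg bf gb; case: i => [n|n] ij.
  have {ij} -> : j = Posz n.+1 by rewrite ij -PoszD addn1.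
  have dex k := is_delta_ex n (fg k).
  pose d k := projT1 (cid (dex k)).
  have dP k : is_delta (f k) (g k) (d k) := projT2 (cid (dex k)).
  move: d dP => d dP; exists d => k.
  have [? ? ? _] := is_delta_exact (fg k) (dP k); split=> //.
  exact: is_delta_nat (fg k.+1) (bf k) (gb k) (dP k.+1) (dP k).
exists (fun k => \0) => k; split=> [q|q|q|q]; last by rewrite /= linear0.
- by split=> _; [exists 0|]; exact: loccoh_neg.
- by split=> _ //; exists 0; exact: loccoh_neg.
case: n ij => [|n] ij.
  have {ij} ij : j = Posz 0 by rewrite ij.
  move: q; rewrite ij => q.
  have [d dP] := is_delta_ex 0 (fg k); have [_ _ _ inj0] := is_delta_exact (fg k) dP.
  split=> [/inj0 ->|[p <-]]; first by exists 0.
  by rewrite linear0.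
have {ij} ij : j = Negz n by rewrite ij !NegzE -[n.+2]addn1 PoszD opprD subrK.
move: q; rewrite ij => q; split=> _; last exact: loccoh_neg.
by exists 0; exact: loccoh_neg.
Qed.

Section Biproduct.
Context (A X Y C : lmodType R) (p1 : {linear A -> X}) (p2 : {linear A -> Y}).
Context (q1 : {linear X -> C}) (q2 : {linear Y -> C}).

Definition copair_map : {linear (X * Y)%type -> C} := (q1 \o fst) \+ (q2 \o snd).

Definition loccoh_pair i : {linear loccoh m i A -> (loccoh m i X * loccoh m i Y)%type} :=
  pair_map (loccoh_map m i p1) (loccoh_map m i p2).
Definition loccoh_copair i : {linear (loccoh m i X * loccoh m i Y)%type -> loccoh m i C} :=
  (loccoh_map m i q1 \o fst) \+ (loccoh_map m i q2 \o snd).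

Let inX : {linear X -> (X * Y)%type} := pair_map idfun \0.
Let inY : {linear Y -> (X * Y)%type} := pair_map \0 idfun.
Let to_pair i (z : loccoh m i (X * Y)%type) : loccoh m i X * loccoh m i Y :=
  (loccoh_map m i fst z, loccoh_map m i snd z).
Let of_pair i (z : loccoh m i X * loccoh m i Y) : loccoh m i (X * Y)%type :=
  loccoh_map m i inX z.1 + loccoh_map m i inY z.2.

Let to_pairK i z : of_pair (@to_pair i z) = z.
Proof.
pose F : {linear (X * Y)%type -> (X * Y)%type} := inX \o fst.
pose G : {linear (X * Y)%type -> (X * Y)%type} := inY \o snd.
rewrite /of_pair /to_pair /= -(@loccoh_map_comp _ m _ _ _ _ _ _ F) //.
rewrite -(@loccoh_map_comp _ m _ _ _ _ _ _ G) // -[loccoh_map m i F z]scale1r.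
rewrite -(@loccoh_map_lin _ m i _ _ 1 F G idfun) ?(@loccoh_map_id _ m i _ idfun) //.
by move=> [x y]; rewrite scale1r; apply: (congr2 pair) => /=; rewrite ?addr0 ?add0r.
Qed.

Let of_pairK i z : to_pair (@of_pair i z) = z.
Proof.
case: z => x y; apply: (congr2 pair); rewrite /of_pair /= linearD.
  rewrite -(@loccoh_map_comp _ m _ _ _ _ inX fst (fst \o inX)) //.
  rewrite -(@loccoh_map_comp _ m _ _ _ _ inY fst (fst \o inY)) //.
  by rewrite loccoh_map_id // loccoh_map0 // addr0.
rewrite -(@loccoh_map_comp _ m _ _ _ _ inX snd (snd \o inX)) //.
rewrite -(@loccoh_map_comp _ m _ _ _ _ inY snd (snd \o inY)) //.
by rewrite loccoh_map0 // loccoh_map_id // add0r.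
Qed.

Let pairE i x : loccoh_pair i x = to_pair (loccoh_map m i (pair_map p1 p2) x).
Proof. by apply: (congr2 pair); exact: loccoh_map_comp. Qed.

Let copairE i z : loccoh_copair i z = loccoh_map m i copair_map (of_pair z).
Proof.
rewrite /of_pair linearD -(@loccoh_map_comp _ m i _ _ _ _ _ q1).
  rewrite -(@loccoh_map_comp _ m i _ _ _ _ _ q2) //.
  by move=> x; rewrite /= linear0 add0r.
by move=> x; rewrite /= linear0 addr0.
Qed.

(** [to_pair] and [of_pair] are inverse isomorphisms between the cohomology of a direct sum and the
    direct sum of the cohomologies; exactness is carried across them. *)
Lemma exact_biproduct i j (delta : {linear loccoh m i C -> loccoh m j A}) :
  exact_at (loccoh_map m i (pair_map p1 p2)) (loccoh_map m i copair_map) ->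
  exact_at (loccoh_map m i copair_map) delta ->
  exact_at delta (loccoh_map m j (pair_map p1 p2)) ->
  [/\ exact_at (loccoh_pair i) (loccoh_copair i), exact_at (loccoh_copair i) delta &
      exact_at delta (loccoh_pair j)].
Proof.
move=> e1 e2 e3; split=> z.
- rewrite copairE; apply: (iff_trans (e1 _)).
  split=> -[x xE]; exists x; first by rewrite pairE xE of_pairK.
  by rewrite -xE pairE to_pairK.
- apply: (iff_trans (e2 _)); split=> -[x xE]; last by exists (of_pair x); rewrite -copairE.
  by exists (to_pair x); rewrite copairE to_pairK.
- apply: (iff_trans _ (e3 _)); rewrite pairE; split=> [zE|->].
    by rewrite -[LHS]to_pairK zE /of_pair !linear0 addr0.
  by rewrite /to_pair !linear0.
Qed.

End Biproduct.

End LongExactSequence.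

(** * Artinianness *)

Section Artinian.
Context (R : comNzRingType).
Implicit Types X Y Z : lmodType R.

Definition artinian X : Prop := forall S : nat -> submod X,
  (forall n x, S n.+1 x -> S n x) -> exists N, forall n x, S N x -> S n x.

Lemma chain_ge X (S : nat -> submod X) : (forall n x, S n.+1 x -> S n x) ->
  forall k n x, (k <= n)%N -> S n x -> S k x.
Proof.
by move=> Sdec k n x /subnK <-; elim: (n - k)%N => // l IH; rewrite addSn => /Sdec.
Qed.

Program Definition submod_image X Y (f : {linear X -> Y}) (S : submod X) : submod Y :=
  @Submod R Y [set f x | x in carrier S] _ _.
Next Obligation. by move=> X Y f S; exists 0; [exact: submod0 | exact: linear0]. Qed.
Next Obligation.
move=> X Y f S a _ _ [x Sx <-] [y Sy <-].
by exists (a *: x + y); [exact: submodL | exact: linearP].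
Qed.

(** Nested submodules of [Y] coincide once their preimages in [X] and their images in [Z] do. *)
Lemma artinian_exact X Y Z (f : {linear X -> Y}) (g : {linear Y -> Z}) :
  exact_at f g -> artinian X -> artinian Z -> artinian Y.
Proof.
move=> fg Xart Zart S Sdec.
have [n x|N1 SN1] := Xart (fun n => submod_preim (S n) f); first exact: Sdec.
have [n _ [y Sy <-]|N2 SN2] := Zart (fun n => submod_image g (S n)).
  by exists y => //; exact: Sdec.
exists (maxn N1 N2) => n y SNy; pose n' := maxn n (maxn N1 N2).
apply: (chain_ge Sdec (leq_maxl n (maxn N1 N2))); rewrite -/n'.
have [|y' Sy' yy'] := SN2 n' (g y).
  by exists y => //; exact: chain_ge (leq_maxr _ _) SNy.
have Sny' : S N1 y' by apply: chain_ge Sy' => //; rewrite /n' maxnCA leq_maxl.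
have [|x xE] := (fg (y - y')).1; first by rewrite linearB yy' subrr.
rewrite -(subrK y' y); apply: submodD => //; rewrite -xE; apply: SN1.
by rewrite /= xE; apply: submodB => //; exact: chain_ge (leq_maxl _ _) SNy.
Qed.

Lemma artinian_surj X Y (f : {linear X -> Y}) :
  (forall y, exists x, f x = y) -> artinian X -> artinian Y.
Proof.
move=> f_surj Xart; apply: (@artinian_exact X Y 'rV[R]_0 f \0) Xart _ => //.
by move=> S _; exists 0%N => n x _; rewrite [x]thinmx0; exact: submod0.
Qed.

Lemma artinian_subsingleton X : (forall x : X, x = 0) -> artinian X.
Proof. by move=> X0 S _; exists 0%N => n x _; rewrite (X0 x); exact: submod0. Qed.

(* Along a chain, a submodule [S] of [Y] is determined by the submodules
   [x ^ k (S \cap (0 : x ^ k.+1))] of [(0 : x)], pulled back to [X]. *)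
Lemma artinian_torsion X Y (u : {linear X -> Y}) (x : R) :
  artinian X -> exact_at u ( *:%R x : {linear Y -> Y}) ->
  (forall y : Y, exists k, x ^+ k *: y = 0) -> artinian Y.
Proof.
move=> Xart ux xtor S Sdec.
pose L k n := submod_preim (submod_image ( *:%R (x ^+ k) : {linear Y -> Y}) (S n)) u.
have Ldec k l n p w : (k <= l)%N -> (n <= p)%N -> L l p w -> L k n w.
  move=> kl np [y Sy yE]; exists (x ^+ (l - k) *: y).
    exact/submodZ/(chain_ge Sdec np).
  by rewrite /= scalerA -exprD subnKC.
(* [L] decreases in both indices. Stabilisation of the diagonal settles every [k >= N0] at once, and
   the finitely many smaller [k] are treated one by one. *)
have [n w|N0 LN0] := Xart (fun n => L n n); first exact: Ldec.
have [N1 LN1] : exists N1, forall k, (k < N0)%N -> forall n w, L k N1 w -> L k n w.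
  elim: N0 {LN0} => [|N0 [N1 LN1]]; first by exists 0%N.
  have [n w|N2 LN2] := Xart (fun n => L N0 n); first exact: Ldec.
  exists (maxn N1 N2) => k; rewrite ltnS leq_eqVlt => /orP[/eqP ->|kN0] n w Lw.
    by apply: LN2; apply: Ldec Lw; rewrite ?leq_maxr.
  by apply: LN1 => //; apply: Ldec Lw; rewrite ?leq_maxl.
exists (maxn N0 N1) => n y SNy; pose n' := maxn n (maxn N0 N1).
apply: (chain_ge Sdec (leq_maxl n (maxn N0 N1))); rewrite -/n'.
have LN k w : L k (maxn N0 N1) w -> L k n' w.
  move=> Lw; have [kN0|N0k] := ltnP k N0.
    by apply: LN1 => //; apply: Ldec Lw; rewrite ?leq_maxr.
  apply: (Ldec k (maxn k n') n' (maxn k n')); rewrite ?leq_maxl ?leq_maxr //.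
  by apply: LN0; apply: Ldec Lw; rewrite ?leq_maxl.
(* Induction on the power of [x] killing [y]: subtracting some [y'] of [S n'] with the same multiple
   by [x ^+ k] lowers that power by one. *)
have [k] := xtor y; elim: k y SNy => [|k IH] y SNy.
  by rewrite expr0 scale1r => ->; exact: submod0.
rewrite exprS -scalerA => /ux [w wE].
have [|y' Sy' y'E] := LN k w; first by exists y.
rewrite -(subrK y' y); apply: submodD => //; apply: IH.
  by apply: submodB => //; apply: chain_ge Sy' => //; exact: leq_maxr.
by rewrite scalerBr -wE -y'E subrr.
Qed.

End Artinian.

(** * Local cohomology of injective and of torsion modules *)

Section TorsionModules.
Context (R : comNzRingType) (m : ideal R) (R_noeth : noetherian R).
Implicit Types M N : lmodType R.

(** Take [W] for the image of [f] and the image of the kernel of [g]. Then [g] factors through [B/W]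
    on the image of [f], and extends from there to a map [k] into [E]. By [essential_torsion] every
    element of [B/W] is torsion, so [k] lands in the torsion part. *)
Lemma Gamma_injective (E : lmodType R) :
  injective_mod E -> injective_mod (submodType (Gamma m E)).
Proof.
move=> Einj A B f g f_inj.
pose P := submod_image f (submod_ker g); pose A' := submod_im f.
have [W [PW WA ess]] := zorn_submod A' P.
have [x /= /(_ =P _)|k kE] := @injective_factor _ _ _ E (qproj W \o f) (val \o g) Einj.
  rewrite -(linear0 (qproj W)) => /eqP/qproj_eq; rewrite subr0 => Wfx.
  have [|y gy /f_inj xy] := WA _ Wfx; first by exists x.
  by rewrite -xy gy.
have Gk b : Gamma m E (k (qproj W b)).
  have [|l Wl] := essential_torsion R_noeth (c := m) (acc_span R_noeth (s := [:: b])) PW WA ess.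
    move=> r _ mr [y _ <-]; have [n gn] := submod_valP (g y).
    exists n, (r ^+ n *: y); last by rewrite linearZ.
    by rewrite /= linearZ; apply: val_inj; apply: gn; exact: ideal_expX.
  exists l => r mr; rewrite -!linearZ /= -[RHS](linear0 k) -(linear0 (qproj W)).
  congr (k _); apply/qproj_eq; rewrite subr0; apply: Wl => //.
  by apply: span_incl; rewrite /= inE.
have [a b b' y y' yE y'E|b|y yE|h hP] :=
  @linear_of_rel _ B (submodType (Gamma m E)) (fun b y => val y = (k \o qproj W) b).
- by rewrite -[LHS]/(a *: val y + val y') yE y'E [in RHS]linearP.
- by exists (insubm (Gk b)).
- by apply: val_inj; rewrite yE linear0.
- by exists h => x; apply/hP; rewrite -[LHS]kE.
Qed.

(** A retraction of the augmentation gives a chain map over the identity that is zero in positive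
    degrees; it induces the identity on cohomology. *)
Lemma loccoh_injective n M (I : injres M) : injective_mod M ->
  forall q : cohom (Gamma_cpx m I) n.+1, q = 0.
Proof.
move=> Minj q; have [r rE] := Minj _ _ (aug I) idfun (aug_inj (i := I)).
pose phi k : {linear I k -> I k} := if k is 0 then aug I \o r else \0.
have phiP k x : phi k.+1 (cdiff I k x) = cdiff I k (phi k x).
  case: k x => [|k] x; last by rewrite [RHS]linear0.
  by apply/esym/aug_exact; exists (r x).
have [x qx] := rep_ex q.
rewrite -[q]cohom_map_id (@cohom_map_eq _ m _ _ I I _ (ChainMap phiP)).
  exact: rep_fun (rep_map (ChainMap phiP) qx) (rep0 _ _ _).
by move=> y; rewrite /= rE.
Qed.

Definition torsion M : Prop := forall x, Gamma m M x.

(** The degree 0 cocycles of the resolution are the augmented copy of [M], and all of them are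
    torsion when [M] is. *)
Lemma loccoh0_augP M : torsion M -> exists e : {linear M -> loccoh m (Posz 0) M},
  (forall x, rep (e x : cohom (Gamma_cpx m (res M)) 0) (aug (res M) x)) /\
  forall q, exists x, e x = q.
Proof.
move=> Mtor.
have [a x x' q q' qx q'x'|x|q q0|e eP] := @linear_of_rel _ M (loccoh m (Posz 0) M)
  (fun x q => rep (q : cohom (Gamma_cpx m (res M)) 0) (aug (res M) x)).
- by rewrite linearP; exact: rep_lin.
- by apply: rep_intro; [exact: Gamma_map | apply/aug_exact; exists x].
- by apply/(rep_eq0 q0); rewrite /= linear0.
exists e; split=> [x|q]; first exact/eP.
have [y qy] := rep_ex (q : cohom (Gamma_cpx m (res M)) 0).
by have /aug_exact [x xy] := rep_cocycle qy; exists x; apply/eP; rewrite xy.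
Qed.

Lemma loccoh0_surj M N (g : {linear M -> N}) : torsion M -> torsion N ->
  (forall y, exists x, g x = y) ->
  forall q, exists p, loccoh_map m (Posz 0) g p = q.
Proof.
move=> Mtor Ntor g_surj q.
have [e [eP _]] := loccoh0_augP Mtor; have [e' [e'P e'_surj]] := loccoh0_augP Ntor.
have [y <-] := e'_surj q; have [x <-] := g_surj y; exists (e x).
apply: (rep_fun (rep_map (Defs.lift (res M) (res N) g) (eP x))).
by rewrite liftP; exact: e'P.
Qed.

Lemma torsion_embedding M : torsion M -> exists (T : lmodType R) (f : {linear M -> T}),
  [/\ torsion T, injective_mod T & injective f].
Proof.
move=> Mtor; pose T : lmodType R := submodType (Gamma m (inj_hull M)).
have [a x x' y y' yE y'E|x|y yE|f fP] :=
  @linear_of_rel _ M T (fun x t => val t = inj_in x).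
- by rewrite -[LHS]/(a *: val y + val y') yE y'E linearP.
- by exists (insubm (Gamma_map (@inj_in R M) (Mtor x))).
- by apply: val_inj; rewrite /= yE raddf0.
exists T, f; split=> [t||x y xy].
- by have [k tk] := submod_valP t; exists k => r mr; apply: val_inj; exact: tk.
- exact/Gamma_injective/inj_hull_injective.
- by apply: inj_in_inj; rewrite -((fP x (f x)).2 erefl) xy; exact: (fP y (f y)).2.
Qed.

Lemma short_exact_quot (A B : lmodType R) (f : {linear A -> B}) :
  injective f -> short_exact f (qproj (submod_im f)).
Proof.
move=> f_inj; split=> // [y|q]; last by exists (qrepr q); exact: qreprK.
rewrite -(linear0 (qproj (submod_im f))); apply: (iff_trans (qproj_eq _ _ _)).
by rewrite subr0; split=> [[x _ <-]|[x <-]]; exists x.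
Qed.

Lemma torsion_quot M (S : submod M) : torsion M -> torsion (quotmod S).
Proof. by move=> Mtor q; rewrite -[q]qreprK; exact/Gamma_map/Mtor. Qed.

(** Dimension shifting along an embedding into a torsion injective [T]. In degree 1, [H^0(T)] maps
    onto [H^0(T/M)], so the connecting map vanishes; above that, induction applies to the torsion
    module [T/M]. *)
Lemma loccoh_torsion n M : torsion M -> forall q : loccoh m (Posz n.+1) M, q = 0.
Proof.
elim: n M => [|n IH] M Mtor q; have [T [f [Ttor Tinj f_inj]]] := torsion_embedding Mtor;
  have fg := short_exact_quot f_inj.
  have [d dP] := is_delta_ex m 0 fg; have [_ e1 e2 _] := is_delta_exact fg dP.
  have [p <-] := (e2 q).1 (loccoh_injective (I := res T) Tinj _).
  apply/e1; apply: loccoh0_surj => //; first exact: torsion_quot.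
  by move=> y; exists (qrepr y); exact: qreprK.
have [d dP] := is_delta_ex m n.+1 fg; have [_ _ e2 _] := is_delta_exact fg dP.
have [p <-] := (e2 q).1 (loccoh_injective (I := res T) Tinj _).
by rewrite (IH _ (torsion_quot Ttor) p) linear0.
Qed.

Lemma loccoh_torsion_artinian n M : torsion M -> artinian M -> artinian (loccoh m (Posz n) M).
Proof.
case: n => [|n] Mtor Mart; last exact/artinian_subsingleton/loccoh_torsion.
by have [e [_ e_surj]] := loccoh0_augP Mtor; exact: artinian_surj e_surj Mart.
Qed.

End TorsionModules.

(** * Local cohomology of finitely generated modules is Artinian *)

Section Artinianness.
Context (R : comNzRingType) (m : ideal R).
Context (R_noeth : noetherian R) (m_max : maximal_ideal m).
Implicit Types (M : lmodType R) (c : ideal R).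

Lemma noetherian_ind (P : ideal R -> Prop) :
  (forall c, (forall c', c `<=` c' -> ~ c' `<=` c -> P c') -> P c) -> forall c, P c.
Proof.
move=> IH c; apply: contrapT => nPc.
have step (b : {b | ~ P b}) :
    {c' : {c' | ~ P c'} | sval b `<=` sval c' /\ ~ sval c' `<=` sval b}.
  apply: cid; apply: contrapT => none; apply: (svalP b); apply: IH => c' cc' c'c.
  by apply: contrapT => nPc'; apply: none; exists (exist _ c' nPc').
pose S := fix S n : {c | ~ P c} := if n is k.+1 then sval (step (S k)) else exist _ c nPc.
have [n x||N SN] := noetherian_acc R_noeth (S := fun n => sval (S n)) => //.
  exact: (svalP (step (S n))).1.
by apply: (svalP (step (S N))).2; exact: SN N.+1.
Qed.

Lemma loccoh_annihilated n M (q : loccoh m (Posz n) M) (x : R) :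
  m x -> exists k, x ^+ k *: q = 0.
Proof.
move=> mx; have [z qz] := rep_ex (q : cohom (Gamma_cpx m (res M)) n).
have [k kz] := rep_gamma qz; exists k.
have := rep_lin (x ^+ k) qz (rep0 _ _ _); rewrite kz ?addr0; last exact: ideal_expX.
by move=> qz'; exact: rep_fun qz' (rep0 _ _ _).
Qed.

Lemma maximal_unit (r : R) : ~ m r -> exists s t, m t /\ s * r + t = 1.
Proof.
move=> nmr; have [nm1 mmax] := m_max.
pose c := submod_add m (submod_span [set` [:: r : R^o]]).
have cr : c r.
  exists 0; first exact: submod0.
  by exists r; [apply/span1P; exists 1; rewrite scale1r | exact: add0r].
have mc : m `<=` c.
  by move=> x mx; exists x => //; exists 0; [exact: submod0 | exact: addr0].
have [t mt [_ /span1P [s ->] ts]] : c 1.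
  by apply: contrapT => nc1; apply: nmr; rewrite -(mmax c mc nc1).
by exists s, t; split=> //; rewrite addrC.
Qed.

Lemma loccoh_add_artinian (A B C : lmodType R) (f : {linear A -> B}) (g : {linear B -> C}) n :
  short_exact f g -> artinian (loccoh m (Posz n) A) -> artinian (loccoh m (Posz n) C) ->
  artinian (loccoh m (Posz n) B).
Proof.
move=> fg; have [d dP] := is_delta_ex m n fg.
by have [e _ _ _] := is_delta_exact fg dP; exact: artinian_exact e.
Qed.

Lemma short_exact_sub M (S : submod M) :
  short_exact (val : {linear submodType S -> M}) (qproj S).
Proof.
split=> [|y|q]; [exact: val_inj| |by exists (qrepr q); exact: qreprK].
rewrite -(linear0 (qproj S)); apply: (iff_trans (qproj_eq _ _ _)); rewrite subr0.
by split=> [Sy|[x <-]]; [exists (insubm Sy) | exact: submod_valP].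
Qed.

(** Scalars outside [m] are invertible modulo [m], so a submodule of [M] either contains [x] or is
    zero. *)
Lemma cyclic_artinian M (x : M) : (forall y, exists r : R, y = r *: x) ->
  (forall r : R, m r -> r *: x = 0) -> artinian M.
Proof.
move=> xgen xm S Sdec.
have [all_x|] := pselect (forall n, S n x).
  by exists 0%N => n y _; have [r ->] := xgen y; exact/submodZ/all_x.
move=> /existsNP [N SNx]; exists N => n y SNy; have [r yE] := xgen y.
have [mr|/maximal_unit [s [t [mt st]]]] := pselect (m r).
  by rewrite yE xm //; exact: submod0.
exfalso; apply: SNx; have -> : x = s *: y; last exact: submodZ.
by rewrite yE scalerA -[LHS]scale1r -st scalerDl (xm t) // addr0.
Qed.

(** [M] is a copy of [R/c]. Keeping it abstract lets the induction hypothesis apply directly to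
    quotients and submodules of [M]. *)
Lemma loccoh_cyclic_artinian c M (x : M) n :
  (forall y, exists r : R, y = r *: x) -> (forall r : R, r *: x = 0 <-> c r) ->
  artinian (loccoh m (Posz n) M).
Proof.
move: c M x n; apply: noetherian_ind => c IH M x n xgen xann.
have [[y my ncy]|mc] := pselect (exists2 y : R, m y & ~ c y); last first.
  have {}mc r : m r -> r *: x = 0.
    by move=> mr; apply/xann; apply: contrapT => ncr; apply: mc; exists r.
  apply: loccoh_torsion_artinian => //; last exact: cyclic_artinian xgen mc.
  move=> z; have [s ->] := xgen z; exists 1%N => r /ideal_exp1 mr.
  by rewrite scalerA mulrC -scalerA mc // scaler0.
pose S := submod_im ( *:%R y : {linear M -> M}).
(* The annihilator [c1] of the image of [x] contains [c], and also [y], which is not in [c]. *)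
have Hquot k : artinian (loccoh m (Posz k) (quotmod S)).
  pose c1 := submod_preim S (smul_at x).
  apply: (IH c1 _ _ _ (qproj S x)) => [r /xann rx0||q|r].
  - by change (S (r *: x)); rewrite rx0; exact: submod0.
  - by move=> /(_ y) cy; apply: ncy; apply: cy; exists x.
  - by have [r rE] := xgen (qrepr q); exists r; rewrite -linearZ -rE; exact: esym (qreprK q).
  - rewrite -linearZ -(linear0 (qproj S)); apply: (iff_trans (qproj_eq _ _ _)).
    by rewrite subr0.
(* This is the colon ideal [(c : y)], the annihilator of the generator [y *: x] of [S]. *)
pose c2 := submod_ker (smul_at (y *: x)).
have cc2 : c `<=` c2.
  by move=> r /xann rx0; rewrite /= /smul_at scalerA mulrC -scalerA rx0 scaler0.
have [c2c|nc2c] := pselect (c2 `<=` c).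
  have y_inj : injective ( *:%R y : {linear M -> M}).
    apply: raddf_inj => z; have [r ->] := xgen z; rewrite /= => yrx0.
    by apply/xann/c2c; rewrite /= /smul_at scalerA mulrC -scalerA.
  have fg := short_exact_quot y_inj.
  have HyE k (q : loccoh m (Posz k) M) :
      loccoh_map m (Posz k) ( *:%R y : {linear M -> M}) q = y *: q.
    rewrite (@loccoh_map_lin _ m k _ _ y idfun \0) => [|z]; last by rewrite /= addr0.
    by rewrite loccoh_map_id // (@loccoh_map0 _ m k _ _ \0) // addr0.
  case: n => [|n].
    have [d dP] := is_delta_ex m 0 fg; have [_ _ _ inj0] := is_delta_exact fg dP.
    (* In degree 0 multiplication by [y] is injective, so the zero module covers its kernel; in
       higher degrees the cohomology of [M/yM] one degree below does. *)
    apply: (@artinian_torsion _ 'rV[R]_0 _ \0 y).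
    - by apply: artinian_subsingleton => z; exact: thinmx0.
    - move=> q; split=> [yq0|[z <-]]; last by rewrite linear0.
      by exists 0; apply/esym/inj0; rewrite HyE.
    - by move=> q; exact: loccoh_annihilated.
  have [d dP] := is_delta_ex m n fg; have [_ _ e _] := is_delta_exact fg dP.
  apply: (artinian_torsion (u := d) (x := y) (Hquot n)) => q.
  - by apply: (iff_trans _ (e q)); rewrite HyE.
  - exact: loccoh_annihilated.
apply: (loccoh_add_artinian (short_exact_sub S)); last exact: Hquot.
have yxS : S (y *: x) by exists x.
apply: (IH c2 cc2 nc2c _ (insubm yxS)) => [z|r].
  have [u _ uE] := submod_valP z; have [r rE] := xgen u; exists r.
  apply: val_inj; rewrite -uE -[RHS]/(r *: (y *: x)) rE /=.
  by rewrite !scalerA mulrC.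
split=> [/(congr1 val)|rx] //; exact: val_inj.
Qed.

(** Induction on the number of generators, splitting off the cyclic submodule generated by the first
    one. *)
Lemma loccoh_artinian i M : fin_gen (submod_top M) -> artinian (loccoh m i M).
Proof.
case: i => n [s sE]; last by apply: artinian_subsingleton => q; exact: loccoh_neg.
have {sE} : forall y, submod_span [set` s] y by move=> y; rewrite -sE.
have [k] := ubnP (size s); elim: k M s => // k IH M [|x s] sk sgen.
  apply: (@loccoh_cyclic_artinian (submod_top _) M 0) => [y|r].
    by exists 0; rewrite scaler0; apply: (sgen y (submod_ker idfun)) => z; rewrite /= inE.
  by rewrite scaler0.
pose S := submod_span [set` [:: x]].
have Sx : S x by apply/span1P; exists 1; rewrite scale1r.
apply: (loccoh_add_artinian (short_exact_sub S)).
  apply: (@loccoh_cyclic_artinian (submod_ker (smul_at x)) _ (insubm Sx)) => [z|r].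
    by have /span1P [r rE] := submod_valP z; exists r; exact: val_inj.
  by split=> [/(congr1 val)|rx] //; exact: val_inj.
apply: (IH _ (map (qproj S) s)) => [|q]; first by rewrite size_map.
have [r _ [z sz qE]] := (span_consP _ _ _).1 (sgen (qrepr q)).
have -> : q = qproj S z.
  rewrite -[LHS]qreprK; apply/qproj_eq; rewrite qE addrK; exact: submodZ.
apply: (sz (submod_preim (submod_span [set` map (qproj S) s]) (qproj S))) => w ws.
by apply: span_incl; exact: map_f.
Qed.

End Artinianness.

(** * Inverse limits *)

Section InverseLimits.
Context (R : comNzRingType).
Implicit Types X Y : nat -> lmodType R.

Definition lim_coord (X : nat -> lmodType R) (t : forall n, {linear X n.+1 -> X n})
  (x : invlim t) (n : nat) : X n := (val x : dprod X) n.

Lemma lim_coordP X t (x : @invlim R X t) n : t n (lim_coord x n.+1) = lim_coord x n.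
Proof. exact: (submod_valP x) n. Qed.

Lemma lim_coord_inj X t (x y : @invlim R X t) :
  (forall n, lim_coord x n = lim_coord y n) -> x = y.
Proof. by move=> xy; apply: val_inj; exact: functional_extensionality_dep. Qed.

Lemma lim_coordL X t a (x y : @invlim R X t) n :
  lim_coord (a *: x + y) n = a *: lim_coord x n + lim_coord y n.
Proof. by []. Qed.

Lemma lim_intro X (t : forall n, {linear X n.+1 -> X n}) (x : forall n, X n) :
  (forall n, t n (x n.+1) = x n) -> exists y : @invlim R X t, forall n, lim_coord y n = x n.
Proof.
move=> tx; have cx : compatible t (x : dprod X) by [].
by exists (insubm cx).
Qed.

Lemma lim_map_ex X Y (t : forall n, {linear X n.+1 -> X n})
    (s : forall n, {linear Y n.+1 -> Y n}) (f : forall n, {linear X n -> Y n}) :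
  (forall n x, f n (t n x) = s n (f n.+1 x)) ->
  exists F : {linear invlim t -> @invlim R Y s},
    forall x n, lim_coord (F x) n = f n (lim_coord x n).
Proof.
move=> fts.
have [a x x' y y' xy x'y' n|x|y y0|F FP] := @linear_of_rel R (invlim t) (@invlim R Y s)
  (fun x y => forall n, lim_coord y n = f n (lim_coord x n)).
- by rewrite !lim_coordL linearP xy x'y'.
- by apply: lim_intro => n; rewrite -fts lim_coordP.
- by apply: lim_coord_inj => n; rewrite y0 linear0.
- by exists F => x; exact/FP.
Qed.

(* Nonempty cosets in Artinian modules satisfy the Mittag-Leffler condition. *)
Lemma lim_affine X (t : forall n, {linear X n.+1 -> X n}) (F : forall n, set (X n)) :
  (forall n, artinian (X n)) -> (forall n, F n !=set0) ->
  (forall n a x y z, F n x -> F n y -> F n z -> F n (a *: (x - y) + z)) ->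
  (forall n x, F n.+1 x -> F n (t n x)) ->
  exists x : @invlim R X t, forall n, F n (lim_coord x n).
Proof.
move=> Xart Fn0 Faff tF.
(* [im k n] is the image of [F (n + k)] in [X n]. *)
pose im := fix im k n : set (X n) :=
  if k is k'.+1 then [set t n x | x in im k' n.+1] else F n.
have imn0 k n : im k n !=set0.
  by elim: k n => // k IH n; have [x Fx] := IH n.+1; exists (t n x); exists x.
have im_dec k n x : im k.+1 n x -> im k n x.
  elim: k n x => [|k IH] n x; first by move=> [y Fy <-]; exact: tF.
  by move=> [y Fy <-]; exists y => //; exact: IH.
have im_aff k n a x y z : im k n x -> im k n y -> im k n z -> im k n (a *: (x - y) + z).
  elim: k n x y z => [|k IH] n x y z; first exact: Faff.
  move=> [x' Fx <-] [y' Fy <-] [z' Fz <-].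
  by exists (a *: (x' - y') + z'); [exact: IH | rewrite linearP linearB].
pose dir k n : set (X n) := [set v | exists x y, [/\ im k n x, im k n y & v = x - y]].
have dir0 k n : dir k n 0 by have [x Fx] := imn0 k n; exists x, x; rewrite subrr.
have dirL k n a u v : dir k n u -> dir k n v -> dir k n (a *: u + v).
  move=> [x [y [Fx Fy ->]]] [x' [y' [Fx' Fy' ->]]].
  by exists (a *: (x - y) + x'), y'; split=> //; [exact: im_aff | rewrite addrA].
(* The direction modules stabilise, and nested nonempty cosets with equal directions coincide. *)
have stable n : exists k, forall l x, im k n x -> im l n x.
  have [k v|N SN] := Xart n (fun k => Submod (dir0 k n) (dirL k n)).
    by move=> [x [y [Fx Fy ->]]]; exists x, y; split=> //; exact: im_dec.
  exists N => l x Fx; have [z Fz] := imn0 (maxn N l) n.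
  have im_le k k' y : (k <= k')%N -> im k' n y -> im k n y.
    by move=> /subnK <-; elim: (k' - k)%N => // j IH; rewrite addSn => /im_dec.
  have [|u [v [Fu Fv xz]]] := SN l (x - z).
    by exists x, z; split=> //; exact: im_le (leq_maxl _ _) Fz.
  rewrite -(subrK z x) xz -[u - v]scale1r; apply: im_aff => //.
  exact: im_le (leq_maxr _ _) Fz.
pose G n x := forall k, im k n x.
have [x0 Gx0] : exists x, G 0%N x.
  have [k imk] := stable 0%N; have [x Fx] := imn0 k 0%N.
  by exists x => l; exact: imk.
(* Stable images map onto stable images: with [k] a stable index at level [n.+1], a point of
   [im k.+1 n] has a preimage in [im k n.+1], which is already stable. *)
have Gext n (x : {x | G n x}) : {y : {y | G n.+1 y} | t n (sval y) = sval x}.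
  apply: cid; case: x => x Gx; have [k imk] := stable n.+1.
  have [y Fy yx] := Gx k.+1.
  have Gy : G n.+1 y by move=> l; exact: imk.
  by exists (exist _ y Gy).
pose s := fix s n : {x | G n x} :=
  if n is k.+1 then sval (Gext k (s k)) else exist _ x0 Gx0.
have [n|x xE] := @lim_intro X t (fun n => sval (s n)).
  exact: svalP (Gext n (s n)).
by exists x => n; rewrite xE; exact: (svalP (s n)) 0%N.
Qed.

(** The fibres of [f n] over [y n] are cosets of kernels, to which [lim_affine] applies. *)
Lemma lim_lift X Y (t : forall n, {linear X n.+1 -> X n})
    (s : forall n, {linear Y n.+1 -> Y n}) (f : forall n, {linear X n -> Y n})
    (y : forall n, Y n) :
  (forall n, artinian (X n)) -> (forall n x, f n (t n x) = s n (f n.+1 x)) ->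
  (forall n, s n (y n.+1) = y n) -> (forall n, exists x, f n x = y n) ->
  exists x : @invlim R X t, forall n, f n (lim_coord x n) = y n.
Proof.
move=> Xart fts sy fy.
apply: (@lim_affine X t (fun n => [set x | f n x = y n])) => // [n a u v w /= fu fv fw|n x /= fx].
- by rewrite linearP linearB fu fv fw subrr scaler0 add0r.
- by rewrite fts fx sy.
Qed.

End InverseLimits.

Lemma artinian_prod (R : comNzRingType) (X Y : lmodType R) :
  artinian X -> artinian Y -> artinian (X * Y)%type.
Proof.
move=> Xart Yart.
apply: (@artinian_exact R X (X * Y)%type Y (pair_map idfun \0) snd) Xart Yart.
move=> [x y]; split=> /= [->|[z zE]]; first by exists x.
by have [_ <-] := zE.
Qed.

Lemma loccoh_map_square (R : comNzRingType) (m : ideal R) i (V W V' W' : lmodType R)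
    (t : {linear V -> V'}) (s : {linear W -> W'})
    (h : {linear V -> W}) (h' : {linear V' -> W'}) :
  (forall x, s (h x) = h' (t x)) ->
  forall q, loccoh_map m i h' (loccoh_map m i t q) = loccoh_map m i s (loccoh_map m i h q).
Proof.
move=> sq q; rewrite -(@loccoh_map_comp _ m i _ _ _ t h' (h' \o t)) //.
exact: loccoh_map_comp.
Qed.

(** * The Mayer-Vietoris sequence in the limit *)

Section MayerVietoris.
Context (R : comNzRingType) (m : ideal R).
Context (A X Y C : nat -> lmodType R).
Context (p1 : forall n, {linear A n -> X n}) (p2 : forall n, {linear A n -> Y n}).
Context (q1 : forall n, {linear X n -> C n}) (q2 : forall n, {linear Y n -> C n}).
Context (tA : forall n, {linear A n.+1 -> A n}) (tX : forall n, {linear X n.+1 -> X n}).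
Context (tY : forall n, {linear Y n.+1 -> Y n}) (tC : forall n, {linear C n.+1 -> C n}).

Let limH (V : nat -> lmodType R) (t : forall n, {linear V n.+1 -> V n}) i :=
  invlim (fun n => loccoh_map m i (t n)).

(** An element killed in the limit is killed at each level, so exactness there gives preimages level
    by level; [lim_lift] makes them compatible. The converse inclusions are checked on
    coordinates. *)
Lemma mayer_vietoris_limit :
  (forall n, short_exact (pair_map (p1 n) (p2 n)) (copair_map (q1 n) (q2 n))) ->
  (forall n x, tX n (p1 n.+1 x) = p1 n (tA n x)) ->
  (forall n x, tY n (p2 n.+1 x) = p2 n (tA n x)) ->
  (forall n x, tC n (q1 n.+1 x) = q1 n (tX n x)) ->
  (forall n x, tC n (q2 n.+1 x) = q2 n (tY n x)) ->
  (forall i n, artinian (loccoh m i (A n))) ->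
  (forall i n, artinian (loccoh m i (X n))) ->
  (forall i n, artinian (loccoh m i (Y n))) ->
  (forall i n, artinian (loccoh m i (C n))) ->
  exists (f : forall i, {linear limH tA i -> (limH tX i * limH tY i)%type})
         (g : forall i, {linear (limH tX i * limH tY i)%type -> limH tC i})
         (d : forall i, {linear limH tC i -> limH tA (i + 1)}),
    forall i,
      [/\ exact_at (f i) (g i), exact_at (g i) (d i) & exact_at (d i) (f (i + 1))].
Proof.
move=> ses p1t p2t q1t q2t Aart Xart Yart Cart.
have square (V W : nat -> lmodType R) (t : forall n, {linear V n.+1 -> V n})
    (s : forall n, {linear W n.+1 -> W n}) (h : forall n, {linear V n -> W n}) i :
    (forall n x, s n (h n.+1 x) = h n (t n x)) ->
    exists F : {linear limH t i -> limH s i},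
      forall x n, lim_coord (F x) n = loccoh_map m i (h n) (lim_coord x n).
  by move=> hts; apply: lim_map_ex => n x; exact: loccoh_map_square.
pose P1 i := projT1 (cid (square _ _ _ _ _ i p1t)).
pose P2 i := projT1 (cid (square _ _ _ _ _ i p2t)).
pose Q1 i := projT1 (cid (square _ _ _ _ _ i q1t)).
pose Q2 i := projT1 (cid (square _ _ _ _ _ i q2t)).
have P1E i : forall x n, lim_coord (P1 i x) n = _ := projT2 (cid (square _ _ _ _ _ i p1t)).
have P2E i : forall x n, lim_coord (P2 i x) n = _ := projT2 (cid (square _ _ _ _ _ i p2t)).
have Q1E i : forall x n, lim_coord (Q1 i x) n = _ := projT2 (cid (square _ _ _ _ _ i q1t)).
have Q2E i : forall x n, lim_coord (Q2 i x) n = _ := projT2 (cid (square _ _ _ _ _ i q2t)).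
(* From here on the chosen limit maps are known only through their coordinates. *)
move: P1 P2 Q1 Q2 P1E P2E Q1E Q2E => P1 P2 Q1 Q2 P1E P2E Q1E Q2E.
pose sXY i n : {linear (loccoh m i (X n.+1) * loccoh m i (Y n.+1))%type ->
    (loccoh m i (X n) * loccoh m i (Y n))%type} :=
  pair_map (loccoh_map m i (tX n) \o fst) (loccoh_map m i (tY n) \o snd).
pose f i : {linear limH tA i -> (limH tX i * limH tY i)%type} := pair_map (P1 i) (P2 i).
pose g i : {linear (limH tX i * limH tY i)%type -> limH tC i} :=
  (Q1 i \o fst) \+ (Q2 i \o snd).
suff dex i : exists d : {linear limH tC i -> limH tA (i + 1)},
    [/\ exact_at (f i) (g i), exact_at (g i) d & exact_at d (f (i + 1))].
  by exists f, g, (fun i => projT1 (cid (dex i))) => i; exact: projT2 (cid (dex i)).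
have [|||dl dlP] := @long_exact_system R m A (fun n => (X n * Y n)%type) C _ _
  tA (fun n => pair_map (tX n \o fst) (tY n \o snd)) tC i (i + 1) ses => //.
- by move=> k x; apply: (congr2 pair); [exact: p1t | exact: p2t].
- by move=> k x; rewrite /= linearD q1t q2t.
have lev n : [/\ exact_at (loccoh_pair m (p1 n) (p2 n) i) (loccoh_copair m (q1 n) (q2 n) i),
    exact_at (loccoh_copair m (q1 n) (q2 n) i) (dl n) &
    exact_at (dl n) (loccoh_pair m (p1 n) (p2 n) (i + 1))].
  by have [e1 e2 e3 _] := dlP n; exact: exact_biproduct e1 e2 e3.
have [n x|D DE] := @lim_map_ex R _ _ (fun n => loccoh_map m i (tC n))
  (fun n => loccoh_map m (i + 1) (tA n)) dl.
  by have [_ _ _ ->] := dlP n.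
have gE z n : lim_coord (g i z) n =
    loccoh_copair m (q1 n) (q2 n) i (lim_coord z.1 n, lim_coord z.2 n).
  by rewrite -[LHS]/(lim_coord (Q1 i z.1) n + lim_coord (Q2 i z.2) n) Q1E Q2E.
have fE j x n : (lim_coord (f j x).1 n, lim_coord (f j x).2 n) =
    loccoh_pair m (p1 n) (p2 n) j (lim_coord x n).
  by apply: (congr2 pair); [exact: P1E | exact: P2E].
pose HXY n : lmodType R := (loccoh m i (X n) * loccoh m i (Y n))%type.
exists D; split=> z.
- split=> [gz0|[x <-]]; last first.
    apply: lim_coord_inj => n; rewrite gE fE.
    by have [e1 _ _] := lev n; apply/e1; exists (lim_coord x n).
  have [||n|x xE] := @lim_lift R _ HXY (fun n => loccoh_map m i (tA n)) (sXY i)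
    (fun n => loccoh_pair m (p1 n) (p2 n) i) (fun n => (lim_coord z.1 n, lim_coord z.2 n)) (Aart i).
  + by move=> n x; apply: (congr2 pair); apply: loccoh_map_square.
  + by move=> n; apply: (congr2 pair); exact: lim_coordP.
  + by have [e1 _ _] := lev n; apply/e1; rewrite -gE gz0.
  exists x; rewrite [RHS]surjective_pairing.
  apply: (congr2 pair); apply: lim_coord_inj => n.
    by have := congr1 fst (xE n); rewrite -fE.
  by have := congr1 snd (xE n); rewrite -fE.
- split=> [dz0|[x <-]]; last first.
    apply: lim_coord_inj => n; rewrite DE gE.
    by have [_ e2 _] := lev n; apply/e2; exists (lim_coord x.1 n, lim_coord x.2 n).
  have [n|n x|n|n|w wE] := @lim_lift R HXY _ (sXY i) (fun n => loccoh_map m i (tC n))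
    (fun n => loccoh_copair m (q1 n) (q2 n) i) (lim_coord z).
  + exact: artinian_prod.
  + rewrite /= linearD; congr (_ + _); exact: loccoh_map_square.
  + exact: lim_coordP.
  + by have [_ e2 _] := lev n; apply/e2; rewrite -DE dz0.
  (* The lift lives in the limit of the direct sums; its two components are compatible families
     separately. *)
  have [n|x xE] := @lim_intro R _ (fun n => loccoh_map m i (tX n)) (fun n => (lim_coord w n).1).
    by rewrite -(lim_coordP w n).
  have [n|y yE] := @lim_intro R _ (fun n => loccoh_map m i (tY n)) (fun n => (lim_coord w n).2).
    by rewrite -(lim_coordP w n).
  exists (x, y); apply: lim_coord_inj => n; rewrite gE /= xE yE -wE.
  by case: (lim_coord w n).
- split=> [fz0|[x <-]]; last first.
    apply: (congr2 pair); apply: lim_coord_inj => n.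
      have := congr1 fst (fE (i + 1) (D x) n); rewrite DE /= => ->.
      by have [_ _ e3] := lev n; have /= := (e3 _).2 (ex_intro _ (lim_coord x n) erefl); case.
    have := congr1 snd (fE (i + 1) (D x) n); rewrite DE /= => ->.
    by have [_ _ e3] := lev n; have /= := (e3 _).2 (ex_intro _ (lim_coord x n) erefl); case.
  have [n x|n|n|x xE] := @lim_lift R _ _ (fun n => loccoh_map m i (tC n))
    (fun n => loccoh_map m (i + 1) (tA n)) dl (lim_coord z) (Cart i).
  + by have [_ _ _ ->] := dlP n.
  + exact: lim_coordP.
  + by have [_ _ e3] := lev n; apply/e3; rewrite -fE fz0.
  by exists x; apply: lim_coord_inj => n; rewrite DE xE.
Qed.

End MayerVietoris.

(** * Cofinal filtrations give the same limit *)

Section Filtrations.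
Context (R : comNzRingType) (m : ideal R) (M : lmodType R).

Definition quot_incl (S T : submod M) (ST : forall x, S x -> T x) :
    {linear quotmod S -> quotmod T} := qmap (f := idfun) ST.

Lemma quot_inclE (S T : submod M) ST x : @quot_incl S T ST (qproj S x) = qproj T x.
Proof. exact: (@qmapE _ _ _ _ _ idfun). Qed.

Lemma quot_incl_comp (S T U : submod M) (ST : forall x, S x -> T x) (TU : forall x, T x -> U x)
    (SU : forall x, S x -> U x) q :
  quot_incl SU q = quot_incl TU (quot_incl ST q).
Proof. by rewrite -[q]qreprK !quot_inclE. Qed.

Definition decreasing (S : nat -> submod M) := forall n x, S n.+1 x -> S n x.

Definition filt_coh S (Sdec : decreasing S) i : lmodType R :=
  invlim (fun n => loccoh_map m i (quot_incl (Sdec n))).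

Lemma filt_cohP S (Sdec : decreasing S) i (x : filt_coh Sdec i) k l (lk : forall y, S l y -> S k y) :
  (k <= l)%N -> loccoh_map m i (quot_incl lk) (lim_coord x l) = lim_coord x k.
Proof.
elim: l lk => [|l IH] lk; rewrite leq_eqVlt => /orP[/eqP kl|//].
- by subst k; apply: loccoh_map_id => q; rewrite -[q]qreprK quot_inclE.
- by subst k; apply: loccoh_map_id => q; rewrite -[q]qreprK quot_inclE.
rewrite ltnS => kl.
have lk' : forall y, S l y -> S k y by move=> y; exact: chain_ge.
rewrite (@loccoh_map_comp _ m i _ _ _ (quot_incl (Sdec l)) (quot_incl lk')).
  by rewrite (lim_coordP x l) IH.
exact: quot_incl_comp.
Qed.

(** Coordinate [n] is read off at any level [l] with [T l] inside [S n]. Two such levels give the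
    same value, as both are compared with their maximum. *)
Lemma cofinal_map S T (Sdec : decreasing S) (Tdec : decreasing T) i :
  (forall n, exists l, forall x, T l x -> S n x) ->
  exists F : {linear filt_coh Tdec i -> filt_coh Sdec i},
    forall x n l (ln : forall y, T l y -> S n y),
      lim_coord (F x) n = loccoh_map m i (quot_incl ln) (lim_coord x l).
Proof.
move=> TS.
have indep x n l l' (ln : forall y, T l y -> S n y) (ln' : forall y, T l' y -> S n y) :
    loccoh_map m i (quot_incl ln) (lim_coord (x : filt_coh Tdec i) l) =
    loccoh_map m i (quot_incl ln') (lim_coord x l').
  have pl y : T (maxn l l') y -> T l y by apply: chain_ge (leq_maxl _ _).
  have pl' y : T (maxn l l') y -> T l' y by apply: chain_ge (leq_maxr _ _).
  have pn y : T (maxn l l') y -> S n y by move=> /pl /ln.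
  rewrite -(filt_cohP x pl (leq_maxl _ _)) -(filt_cohP x pl' (leq_maxr _ _)).
  rewrite -(@loccoh_map_comp _ m i _ _ _ _ _ (quot_incl pn)); last exact: quot_incl_comp.
  by rewrite -(@loccoh_map_comp _ m i _ _ _ _ _ (quot_incl pn)) //; exact: quot_incl_comp.
have [a x x' y y' xy x'y' n l ln|x|y y0|F FP] :=
  @linear_of_rel R (filt_coh Tdec i) (filt_coh Sdec i)
  (fun x y => forall n l (ln : forall z, T l z -> S n z),
    lim_coord y n = loccoh_map m i (quot_incl ln) (lim_coord x l)).
- by rewrite !lim_coordL linearP (xy _ _ ln) (x'y' _ _ ln).
- pose lf n := projT1 (cid (TS n)); have lfP n : forall y, T (lf n) y -> S n y := projT2 (cid (TS n)).
  have [n|y yE] := @lim_intro R _ (fun n => loccoh_map m i (quot_incl (Sdec n)))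
    (fun n => loccoh_map m i (quot_incl (lfP n)) (lim_coord x (lf n))).
    have ln y : T (lf n.+1) y -> S n y by move=> /lfP /Sdec.
    rewrite -(@loccoh_map_comp _ m i _ _ _ _ _ (quot_incl ln)); last exact: quot_incl_comp.
    exact: indep.
  by exists y => n l ln; rewrite yE; exact: indep.
- apply: lim_coord_inj => n; have [l ln] := TS n; rewrite (y0 _ _ ln).
  exact: linear0.
- by exists F => x; exact/FP.
Qed.

(** In coordinate [k], a round trip is induced by the projection from some [M/T_l] to [M/T_k], which
    a compatible family respects; choosing [l >= k] makes it a composite of transition maps. *)
Lemma cofinal_iso S T (Sdec : decreasing S) (Tdec : decreasing T) i :
  (forall n, exists l, forall x, T l x -> S n x) ->
  (forall n, exists l, forall x, S l x -> T n x) ->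
  exists (F : {linear filt_coh Tdec i -> filt_coh Sdec i})
         (G : {linear filt_coh Sdec i -> filt_coh Tdec i}), cancel F G /\ cancel G F.
Proof.
move=> TS ST.
have cofinalK S' T' (Sdec' : decreasing S') (Tdec' : decreasing T')
    (F : filt_coh Tdec' i -> filt_coh Sdec' i) (G : filt_coh Sdec' i -> filt_coh Tdec' i) :
    (forall n, exists l, forall x, T' l x -> S' n x) ->
    (forall n, exists l, forall x, S' l x -> T' n x) ->
    (forall x n l (ln : forall y, T' l y -> S' n y),
      lim_coord (F x) n = loccoh_map m i (quot_incl ln) (lim_coord x l)) ->
    (forall x n l (ln : forall y, S' l y -> T' n y),
      lim_coord (G x) n = loccoh_map m i (quot_incl ln) (lim_coord x l)) -> cancel F G.
  move=> TS' ST' FE GE x; apply: lim_coord_inj => k.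
  have [n nk] := ST' k; have [l0 ln0] := TS' n; pose l := maxn k l0.
  have ln y : T' l y -> S' n y by move=> Ty; apply/ln0/(chain_ge Tdec' (leq_maxr k l0)).
  have lk y : T' l y -> T' k y by move=> /ln /nk.
  rewrite (GE _ _ _ nk) (FE _ _ _ ln) -(filt_cohP x lk (leq_maxl _ _)); apply/esym.
  by apply: loccoh_map_comp; exact: quot_incl_comp.
have [F FE] := cofinal_map Sdec Tdec i TS; have [G GE] := cofinal_map Tdec Sdec i ST.
by exists F, G; split; [exact: (cofinalK _ _ Sdec Tdec) | exact: (cofinalK _ _ Tdec Sdec)].
Qed.

End Filtrations.

(** * The square of quotients, and comparison with the adic filtrations *)

Section AdicMayerVietoris.
Context (R : comNzRingType) (M : lmodType R).

Lemma submod_capl (S T : submod M) x : submod_cap S T x -> S x.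
Proof. by case. Qed.
Lemma submod_capr (S T : submod M) x : submod_cap S T x -> T x.
Proof. by case. Qed.
Lemma submod_addl (S T : submod M) x : S x -> submod_add S T x.
Proof. by move=> Sx; exists x => //; exists 0; [exact: submod0 | exact: addr0]. Qed.
Lemma submod_addr (S T : submod M) x : T x -> submod_add S T x.
Proof. by move=> Tx; exists 0; [exact: submod0 | exists x => //; exact: add0r]. Qed.

Lemma short_exact_cap_add (S T : submod M) :
  short_exact (pair_map (quot_incl (@submod_capl S T)) (quot_incl (@submod_capr S T)))
    (copair_map (quot_incl (@submod_addl S T)) (-%R \o quot_incl (@submod_addr S T))).
Proof.
split.
- apply: raddf_inj => q; rewrite -[q]qreprK => -[/=]; rewrite !quot_inclE.
  rewrite -[X in _ = X -> _](linear0 (qproj S)) => /qproj_eq Sx.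
  rewrite -[X in _ = X -> _](linear0 (qproj T)) => /qproj_eq Tx.
  by rewrite -[RHS](linear0 (qproj (submod_cap S T))); apply/qproj_eq.
- move=> [q q']; rewrite -[q]qreprK -[q']qreprK; set x := qrepr q; set y := qrepr q'.
  have -> : copair_map (quot_incl (@submod_addl S T)) (-%R \o quot_incl (@submod_addr S T))
      (qproj S x, qproj T y) = qproj (submod_add S T) x - qproj (submod_add S T) y.
    by rewrite /copair_map /= !quot_inclE.
  split=> [/subr0_eq /qproj_eq [u Su [v Tv uv]]|[z [zx zy]]].
    (* If [x - y = u + v], then [x - u = y + v] represents both given classes. *)
    exists (qproj _ (x - u)); apply: (congr2 pair); rewrite quot_inclE; apply/qproj_eq.
      by rewrite addrAC subrr sub0r; exact: submodN.
    have -> : x - u - y = v by rewrite addrAC -uv addrAC subrr add0r.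
    exact: Tv.
  move: zx zy; rewrite -[z]qreprK !quot_inclE => /qproj_eq Sz /qproj_eq Tz.
  apply/eqP; rewrite subr_eq0; apply/eqP/qproj_eq.
  rewrite -(subrK (qrepr z) x) -addrA; apply: submodD.
    by apply: submod_addl; rewrite -opprB; exact: submodN.
  exact: submod_addr.
- move=> q; exists (qproj S (qrepr q), 0).
  by rewrite /copair_map /= linear0 oppr0 addr0 quot_inclE qreprK.
Qed.

Lemma fin_gen_quot (S : submod M) : fin_gen (submod_top M) -> fin_gen (submod_top (quotmod S)).
Proof.
move=> [s sE]; exists (map (qproj S) s); apply/seteqP; split=> // q _.
have : submod_span [set` s] (qrepr q) by rewrite -sE.
rewrite -{2}[q]qreprK.
apply: (_ : _ `<=` submod_preim (submod_span [set` map (qproj S) s]) (qproj S)).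
move=> x; apply=> y ys; apply: span_incl; exact: map_f.
Qed.

(** Artin-Rees for the submodule [b^n M] puts the intersection of [a^l M] and [b^n M] inside
    [a^n b^n M], hence inside the [n]-th power of the intersection ideal times [M]. *)
Lemma adic_cap_cofinal (a b : ideal R) : noetherian R -> fin_gen (submod_top M) ->
  forall n, exists l, forall x, submod_cap (adic_sub a M l) (adic_sub b M l) x ->
    adic_sub (submod_cap a b) M n x.
Proof.
move=> R_noeth [s sE] n.
have Macc : acc_on (submod_top M).
  move=> S Sinc _; apply: (acc_span R_noeth (s := s)) => // k x _.
  by rewrite -sE.
have [l al] := artin_rees R_noeth a (adic_sub b M n) n Macc.
exists (maxn l n) => x [ax bx].
have := al x (adic_sub_antimono (leq_maxl _ _) ax) (adic_sub_antimono (leq_maxr _ _) bx).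
apply=> _ [r ar [y bny <-]].
have {}bny := bny (submod_preim (adic_sub (submod_cap a b) M n) ( *:%R r : {linear M -> M})).
apply: bny => _ [t bt [z _ <-]] /=; rewrite scalerA.
by apply: adic_subZ; exact: ideal_exp_mul.
Qed.

Lemma adic_add_cofinal (a b : ideal R) n : exists l, forall x,
  adic_sub (submod_add a b) M l x -> submod_add (adic_sub a M n) (adic_sub b M n) x.
Proof.
exists (n + n)%N => x; apply: adic_subP => r y /ideal_exp_add [u au [v bv <-]].
by rewrite scalerDl; exists (u *: y); [|exists (v *: y)] => //; exact: adic_subZ.
Qed.

Lemma adic_sub_mono (a b : ideal R) n x :
  a `<=` b -> adic_sub a M n x -> adic_sub b M n x.
Proof.
by move=> ab; apply: adic_subP => r y ar; apply/adic_subZ/(ideal_exp_sub ab).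
Qed.

End AdicMayerVietoris.

(** * Transport of exactness along isomorphisms, and the final assembly *)

Lemma exact_iso (R : pzRingType) (A A' B B' C C' : lmodType R)
    (f : {linear A -> B}) (g : {linear B -> C}) (f' : {linear A' -> B'}) (g' : {linear B' -> C'})
    (F : {linear A -> A'}) (F' : A' -> A) (H : {linear B -> B'}) (H' : B' -> B)
    (G : {linear C -> C'}) (G' : C' -> C) :
  cancel F' F -> cancel H H' -> cancel H' H -> cancel G G' ->
  (forall x, f' (F x) = H (f x)) -> (forall y, g' (H y) = G (g y)) ->
  exact_at f g -> exact_at f' g'.
Proof.
move=> F'K HK H'K GK fE gE fg y'; rewrite -[y']H'K gE.
apply: (iff_trans (B := g (H' y') = 0)).
  by split=> [gy|->]; [rewrite -[LHS]GK gy -(linear0 G) GK | rewrite linear0].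
apply: (iff_trans (fg _)); split=> -[x xE].
  by exists (F x); rewrite fE xE.
by exists (F' x); apply: (can_inj HK); rewrite -fE F'K.
Qed.

Lemma long_exact_iso (R : pzRingType) (A A' B C C' : int -> lmodType R) :
  (forall i, exists (F : {linear A i -> A' i}) (G : {linear A' i -> A i}),
    cancel F G /\ cancel G F) ->
  (forall i, exists (F : {linear C' i -> C i}) (G : {linear C i -> C' i}),
    cancel F G /\ cancel G F) ->
  (exists (f : forall i, {linear A i -> B i}) (g : forall i, {linear B i -> C i})
     (d : forall i, {linear C i -> A (i + 1)}), forall i,
     [/\ exact_at (f i) (g i), exact_at (g i) (d i) & exact_at (d i) (f (i + 1))]) ->
  exists (f : forall i, {linear A' i -> B i}) (g : forall i, {linear B i -> C' i})
     (d : forall i, {linear C' i -> A' (i + 1)}), forall i,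
     [/\ exact_at (f i) (g i), exact_at (g i) (d i) & exact_at (d i) (f (i + 1))].
Proof.
move=> Aiso Ciso [f [g [d fgd]]].
pose cF i := projT1 (cid (Aiso i)); pose cG i := projT1 (cid (projT2 (cid (Aiso i)))).
pose aF i := projT1 (cid (Ciso i)); pose aG i := projT1 (cid (projT2 (cid (Ciso i)))).
have cFK i : cancel (cF i) (cG i) := (projT2 (cid (projT2 (cid (Aiso i))))).1.
have cGK i : cancel (cG i) (cF i) := (projT2 (cid (projT2 (cid (Aiso i))))).2.
have aFK i : cancel (aF i) (aG i) := (projT2 (cid (projT2 (cid (Ciso i))))).1.
have aGK i : cancel (aG i) (aF i) := (projT2 (cid (projT2 (cid (Ciso i))))).2.
move: cF cG aF aG cFK cGK aFK aGK => cF cG aF aG cFK cGK aFK aGK.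
exists (fun i => f i \o cG i), (fun i => aG i \o g i), (fun i => cF (i + 1) \o (d i \o aF i)).
move=> i; have [e1 e2 e3] := fgd i; split.
- apply: (exact_iso (F := cF i) (H := idfun) (H' := idfun) (G := aG i) (cGK i) _ _ (aGK i) _ _ e1)
    => x //; by rewrite /= cFK.
- apply: (exact_iso (F := idfun) (F' := idfun) (H := aG i) (G := cF (i + 1)) _ (aGK i)
    (aFK i) (cFK (i + 1)) _ _ e2) => x //; by rewrite /= aGK.
- apply: (exact_iso (F := aG i) (H := cF (i + 1)) (G := idfun) (G' := idfun) (aFK i)
    (cFK (i + 1)) (cGK (i + 1)) _ _ _ e3) => x //; by rewrite /= ?aGK ?cFK.
Qed.

Theorem theorem5p1 (R : comNzRingType) (m a b : ideal R) (M : lmodType R)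
  (R_noetherian : noetherian R) (R_local : local_ring m)
  (M_fin_gen : fin_gen (submod_top M)) :
  exists (f : forall i : int, {linear formal_coh m (submod_cap a b) M i ->
                (formal_coh m a M i * formal_coh m b M i)%type})
         (g : forall i : int, {linear (formal_coh m a M i * formal_coh m b M i)%type ->
                formal_coh m (submod_add a b) M i})
         (d : forall i : int, {linear formal_coh m (submod_add a b) M i ->
                formal_coh m (submod_cap a b) M (i + 1)}),
    forall i : int,
      [/\ exact_at (f i) (g i), exact_at (g i) (d i) & exact_at (d i) (f (i + 1))].
Proof.
pose Sa n := adic_sub a M n; pose Sb n := adic_sub b M n.
pose Scap n := submod_cap (Sa n) (Sb n); pose Sadd n := submod_add (Sa n) (Sb n).
have cap_dec : decreasing Scap by move=> n x [ax bx]; split; exact: adic_sub_le.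
have add_dec : decreasing Sadd.
  by move=> n _ [x ax [y bxy <-]]; exists x; [|exists y] => //; exact: adic_sub_le.
have art (S : submod M) i : artinian (loccoh m i (quotmod S)).
  refine (loccoh_artinian R_noetherian R_local.1 (fin_gen_quot S M_fin_gen)).
have [||||||||f [g [d fgd]]] := @mayer_vietoris_limit R m
  (fun n => quotmod (Scap n)) (fun n => quotmod (Sa n))
  (fun n => quotmod (Sb n)) (fun n => quotmod (Sadd n))
  _ _ _ _ (fun n => quot_incl (cap_dec n))
  (fun n => quot_incl (@adic_sub_le R a M n)) (fun n => quot_incl (@adic_sub_le R b M n))
  (fun n => quot_incl (add_dec n)) (fun n => short_exact_cap_add (Sa n) (Sb n)).
- by move=> n q; rewrite -[q]qreprK !quot_inclE.
- by move=> n q; rewrite -[q]qreprK !quot_inclE.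
- by move=> n q; rewrite -[q]qreprK !quot_inclE.
- by move=> n q; rewrite -[q]qreprK /= raddfN /= !quot_inclE.
- by move=> i n; exact: art.
- by move=> i n; exact: art.
- by move=> i n; exact: art.
- by move=> i n; exact: art.
(* These inclusions are the easy halves of the two cofinalities and hold with the same index. *)
have capcof n : exists l, forall x, adic_sub (submod_cap a b) M l x -> Scap n x.
  by exists n => x abx; split; apply: adic_sub_mono abx => r [].
have addcof n : exists l, forall x, Sadd l x -> adic_sub (submod_add a b) M n x.
  exists n => _ [x ax [y bxy <-]]; apply: submodD.
    by apply: adic_sub_mono ax => r; exact: submod_addl.
  by apply: adic_sub_mono bxy => r; exact: submod_addr.
have capiso i := cofinal_iso m (@adic_sub_le R (submod_cap a b) M) cap_dec i
  (adic_cap_cofinal a b R_noetherian M_fin_gen) capcof.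
have addiso i := cofinal_iso m add_dec (@adic_sub_le R (submod_add a b) M) i
  (adic_add_cofinal M a b) addcof.
by apply: (long_exact_iso capiso addiso); exists f, g, d.
Qed.
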